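(* Suppose that $W\in L^p(I^2)$ with $p\ge 2$, let $q=\frac{p}{p-1}$, and let $\mathbf g\in S\subset L^q(I)$. Then, for every $T>0$, the initial value problem $$\frac{\partial x(y,t)}{\partial t}=f(x(y,t))+\int_0^1 W(y,y')\,G(x(y,t),x(y',t))\,\mathrm{d}y',\qquad x(\cdot,0)=\mathbf g,$$ has a unique solution $x\in C^1([0,T];L^q(I))$. This solution exists for all $t\ge 0$, satisfies $x(\cdot,t)\in S$ for all $t\ge 0$, and depends continuously on $\mathbf g$.
   Context: $I=[0,1]$. A graphon is a symmetric measurable function $W:I^2\to[0,1]$. Standing assumptions: (i) $\Omega\subset\mathbb R$ is a bounded closed interval; $f:\Omega\to\mathbb R$ satisfies $|f(x)-f(x')|\le L_f|x-x'|$ for all $x,x'\in\Omega$; $G:\Omega\times\Omega\to\mathbb R$ satisfies $|G(u,v)-G(u',v')|\le L_G\|(u,v)-(u',v')\|_2$ for all $(u,v),(u',v')\in\Omega\times\Omega$. (ii) $S=\{u\in L^q(I): u(y)\in\Omega \text{ for almost every } y\in I\}$ is positively invariant for the graphon dynamical system $\partial_t x(y,t)=f(x(y,t))+\int_0^1W(y,y')G(x(y,t),x(y',t))\,\mathrm{d}y'$: if $x(\cdot,0)\in S$, then $x(\cdot,t)\in S$ for all $t\ge0$. Here $f$ and $G$ are extended (and still denoted $f$, $G$) to globally Lipschitz functions on $\mathbb R$ and $\mathbb R^2$, so that the equation makes sense for arbitrary $L^q(I)$-valued states, and positive invariance means that every solution of the extended equation, on any interval $[0,\tau]$, that starts in $S$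 stays in $S$ on that interval. (iii) $W$ is a graphon that is continuous at almost every point of $I^2$. $C^1([0,T];L^q(I))$ is the space of continuously differentiable maps from $[0,T]$ to $L^q(I)$. Continuous dependence means that the map $\mathbf g\mapsto x$ from $S$ (with the $L^q(I)$ norm) to $C([0,T];L^q(I))$ (with the sup norm) is continuous. *)

(* Defs.v *)
From HB Require Import structures.
From mathcomp Require Import all_boot all_order all_algebra.
From mathcomp Require Import all_classical all_reals all_analysis.

Set Implicit Arguments.
Unset Strict Implicit.
Unset Printing Implicit Defensive.

Import Order.TTheory GRing.Theory Num.Theory.
Import numFieldNormedType.Exports.

Local Open Scope classical_set_scope.
Local Open Scope ring_scope.

(** Lebesgue measure on [I = [0,1]], as a measure on the real line carried by
    [I]; its L^q space is L^q(I). *)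
Definition lebesgueI (R : realType) : set (measurableTypeR R) -> \bar R :=
  mrestr (@lebesgue_measure R) (measurable_itv `[0%R, 1%R]).

HB.instance Definition _ (R : realType) := Measure.on (@lebesgueI R).

Section graphon.
Context {R : realType}.
Implicit Types (W : R * R -> R) (f : R -> R) (G : R -> R -> R).

Definition unit_square : set (R * R) := `[0%R, 1%R] `*` `[0%R, 1%R].

Definition graphon W : Prop :=
  [/\ measurable_fun unit_square W,
      forall y y', unit_square (y, y') -> W (y, y') = W (y', y) &
      forall z, unit_square z -> 0 <= W z <= 1].

Definition ae_continuous W : Prop :=
  {ae (@lebesgue_measure R \x @lebesgue_measure R)%E, forall z,
    unit_square z -> W z' @[z' --> within unit_square (nbhs z)] --> W z}.

Definition Lp_unit_square (p : R) W : Prop :=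
  (@lebesgue_measure R \x @lebesgue_measure R)%E.-integrable unit_square
    (fun z => (`|W z| `^ p)%:E).

(** Lipschitz with respect to the Euclidean norm of the plane (the library's
    norm on [R * R] is the max norm). *)
Definition lipschitz2_on (A : set (R * R)) (L : R) G : Prop :=
  forall u v u' v', A (u, v) -> A (u', v') ->
    `|G u v - G u' v'| <= L * Num.sqrt ((u - u') ^+ 2 + (v - v') ^+ 2).

Definition graphon_field f G W (u : R -> R) (y : R) : R :=
  f (u y) + \int[@lebesgue_measure R]_(y' in `[0, 1]) (W (y, y') * G (u y) (u y')).

Section Lq.
Context (q : R) (q1 : (1 <= q%:E)%E).

Definition LqI : Type := LspaceType (@lebesgueI R) q1.

Definition Lq_dist (u v : R -> R) : \bar R :=
  'N[@lebesgueI R]_q%:E[EFin \o (fun y => u y - v y)].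

Definition sup_dist (T : R) (x z : R -> LqI) : \bar R :=
  ereal_sup [set Lq_dist (x t) (z t) | t in `[0, T]].

(** [x] is continuously differentiable on the interval [J] with derivative
    [x'], in the L^q norm (one-sided at the endpoints of [J]); the values of
    [x] and [x'] outside [J] are irrelevant. *)
Definition C1_on (J : set R) (x x' : R -> LqI) : Prop :=
  (forall t, J t ->
     Lq_dist (fun y => (x s y - x t y) / (s - t)) (x' t)
       @[s --> within J t^'] --> 0%E) /\
  (forall t, J t ->
     Lq_dist (x' s) (x' t) @[s --> within J (nbhs t)] --> 0%E).

Definition is_solution f G W (J : set R) (g : LqI) (x : R -> LqI) : Prop :=
  x 0 = g /\
  exists x' : R -> LqI, C1_on J x x' /\
    forall t, J t ->
      {ae @lebesgueI R, forall y, x' t y = graphon_field f G W (x t) y}.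

Definition state_space (a b : R) (u : LqI) : Prop :=
  {ae @lebesgueI R, forall y, u y \in `[a, b]}.

Definition positively_invariant f G W (S : LqI -> Prop) : Prop :=
  forall tau g x, 0 < tau -> S g -> is_solution f G W `[0, tau] g x ->
    forall t, t \in `[0, tau] -> S (x t).

End Lq.
End graphon.

Arguments state_space {R q} q1 a b u.

Lemma conjugate_ge1 (R : realType) (p : R) :
  2 <= p -> (1 <= (p / (p - 1))%:E)%E.
Proof.
move=> p2; have p1 : 0 < p - 1 by rewrite subr_gt0 (lt_le_trans _ p2)// ltr1n.
by rewrite lee_fin ler_pdivlMr// mul1r gerBl ler01.
Qed.

(* Main.v *)
Require Import Defs.
From HB Require Import structures.
From mathcomp Require Import all_boot all_order all_algebra.
From mathcomp Require Import all_classical all_reals all_analysis.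
From mathcomp Require Import measurable_realfun.
From mathcomp Require Import ring lra.

Set Implicit Arguments.
Unset Strict Implicit.
Unset Printing Implicit Defensive.

Import Order.TTheory GRing.Theory Num.Theory.
Import numFieldNormedType.Exports.

Local Open Scope classical_set_scope.
Local Open Scope ring_scope.

(** The right-hand side of the equation is a globally Lipschitz vector field on
    L^q(I): since 0 <= W <= 1 and I has measure 1, for extensions of f and G
    with Lipschitz constants K1 and K2 (for the l^1 norm of the plane),
    |F u - F v| is bounded pointwise by
    (K1 + K2) |u - v| + K2 ||u - v||_1, and the L^1 norm is at most the L^q
    norm ([kernel_field_dist], [kernel_fieldL_lip]). Existence, uniqueness
    and continuous dependence are therefore those of Cauchy and Lipschitz in
    a complete space, and invariance of S is the hypothesis applied to
    the solution just constructed.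

    The abstract part is carried out in a seminormed space, so that it applies
    to L^q functions before passing to classes modulo almost everywhere
    equality. Existence avoids integrating vector-valued functions: the Euler
    points e_n(t), with step 2^-n, are Cauchy in n, and their discrete Taylor
    expansion passes to the limit as
    N (y s - y t - (s - t) F (y t)) <= C (s - t)^2 ([solution_exists]). This
    quadratic estimate gives both the derivative of y and its continuity.
    Two solutions are compared with a Gronwall lemma that needs only
    one-point estimates at each time ([gronwall], [solves_stable]); it yields
    uniqueness and the Lipschitz dependence on the initial value.

    The completeness of L^q ([Lq_complete]) follows the classical proof: for
    increments of geometric size the sum of the absolute values is integrable,
    so the sequence converges almost everywhere, and Fatou's lemma turns the
    pointwise limit into a limit in norm. *)

(** * A Gronwall lemma for one-point estimates *)

(** Compare phi with B s = (phi 0 + eta (1 + s)) exp (L s), whose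
    increments exceed those allowed to phi with margin eta. By continuity
    phi <= B holds up to the supremum c of the times before which it holds, and
    the margin would carry it beyond c if c < T. Then eta tends to 0. *)
Lemma gronwall (R : realType) (phi : R -> R) (L T : R) : 0 <= L ->
  (forall t, 0 <= t <= T -> 0 <= phi t) ->
  (forall t, 0 <= t <= T -> forall e, 0 < e -> exists2 d, 0 < d &
    forall s, 0 <= s <= T -> `|s - t| < d ->
      `|phi s - phi t| <= `|s - t| * (L * phi t + e)) ->
  forall t, 0 <= t <= T -> phi t <= phi 0 * expR (L * t).
Proof.
move=> L0 phi0 dphi t /andP[t0 tT]; have T0 := le_trans t0 tT.
have f0 : 0 <= phi 0 by rewrite phi0// lexx.
apply/ler_addgt0Pr => e e0.
pose eta := e / ((1 + T) * expR (L * T)).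
have T1 : 0 < (1 + T) * expR (L * T) by rewrite mulr_gt0 ?expR_gt0 ?ltr_wpDr.
have eta_gt0 : 0 < eta by rewrite divr_gt0.
have eta0 := ltW eta_gt0.
have eE : e = eta * ((1 + T) * expR (L * T)) by rewrite divfK// gt_eqF.
clearbody eta.
pose B s := (phi 0 + eta * (1 + s)) * expR (L * s).
suff main : phi t <= B t.
  apply: (le_trans main); rewrite /B mulrDl lerD2l -mulrA.
  rewrite eE ler_wpM2l//.
  by rewrite ler_pM ?expR_ge0 ?addr_ge0// ?lerD2l ?ler_expR ?ler_wpM2l.
have Bge0 s : 0 <= s -> 0 <= B s.
  by move=> s0; rewrite mulr_ge0 ?expR_ge0// addr_ge0// mulr_ge0 ?addr_ge0.
(* increments of B dominate those allowed to phi at a point where phi = B *)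
have Bgrow s s' : 0 <= s -> s <= s' ->
    B s + (s' - s) * (L * B s + eta) <= B s'.
  move=> s0 ss'; have d0 : 0 <= s' - s by rewrite subr_ge0.
  have e1 : 1 <= expR (L * s) by rewrite -expR0 ler_expR mulr_ge0.
  have -> : B s' = expR (L * (s' - s)) * (B s + eta * (s' - s) * expR (L * s)).
    rewrite /B [in LHS](_ : L * s' = L * (s' - s) + L * s); last by ring.
    by rewrite expRD; ring.
  have Bs := Bge0 s s0.
  apply: (@le_trans _ _ ((1 + L * (s' - s)) * (B s + eta * (s' - s)))).
    have : 0 <= L * (s' - s) * (eta * (s' - s)) by rewrite !mulr_ge0.
    lra.
  have es : 0 <= eta * (s' - s) by rewrite mulr_ge0.
  apply: ler_pM; [| |exact: expR_ge1Dx|by rewrite lerD2l ler_peMr].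
  - by rewrite addr_ge0// mulr_ge0.
  - exact: addr_ge0.
have Bmono s s' : 0 <= s -> s <= s' -> B s <= B s'.
  move=> s0 ss'; apply: le_trans (Bgrow s s' s0 ss'); rewrite lerDl.
  have Bs := Bge0 s s0.
  by rewrite mulr_ge0 ?subr_ge0// addr_ge0// mulr_ge0.
have B0 : phi 0 <= B 0.
  by rewrite /B addr0 mulr1 mulr0 expR0 mulr1 lerDl.
pose A := [set c | 0 <= c <= T /\ forall s, 0 <= s <= c -> phi s <= B s].
have A0 : A 0.
  split; first by rewrite lexx.
  by move=> s; rewrite -eq_le => /eqP <-.
have supA : has_sup A.
  by split; [exists 0 | exists T => c [/andP[]]].
pose c := sup A.
have c0 : 0 <= c by apply: ub_le_sup => //; exact: supA.2.
have cT : c <= T by apply: ge_sup; [exists 0 | move=> x [/andP[]]].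
have below s : 0 <= s -> s < c -> phi s <= B s.
  move=> s0 sc.
  have cs0 : 0 < c - s by rewrite subr_gt0.
  have [x [_ Ax] sx] := sup_adherent cs0 supA.
  by apply: Ax; rewrite s0 ltW//; move: sx; rewrite -/c; lra.
have at_c : phi c <= B c.
  have [<-|cn0] := eqVneq 0 c; first exact: B0.
  have cgt0 : 0 < c by rewrite lt_neqAle cn0.
  apply/ler_addgt0Pr => r r0.
  have cI : 0 <= c <= T by rewrite c0.
  have [d d0 Hd] := dphi c cI 1 ltr01.
  have K0 : 0 < L * phi c + 1 by rewrite ltr_wpDl// mulr_ge0// phi0.
  (* a step back from c, so short that phi changes by at most r *)
  pose x := Num.min (Num.min (d / 2) c) (r / (L * phi c + 1)).
  have x0 : 0 < x by rewrite !lt_min !divr_gt0 ?cgt0.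
  have xc : x <= c by rewrite /x !ge_min lexx orbT.
  have xd : x < d.
    by apply: (@le_lt_trans _ _ (d / 2)); [rewrite /x !ge_min lexx | lra].
  have xr : x * (L * phi c + 1) <= r.
    by rewrite -ler_pdivlMr// /x !ge_min lexx !orbT.
  have sub0 : 0 <= c - x by rewrite subr_ge0.
  have cxT : 0 <= c - x <= T by rewrite sub0/=; lra.
  have nx : `|c - x - c| = x by rewrite addrAC subrr add0r normrN gtr0_norm.
  have := Hd (c - x) cxT; rewrite nx => /(_ xd).
  rewrite ler_norml => /andP[lb _].
  have bx : phi (c - x) <= B (c - x) by apply: below => //; lra.
  have mx : B (c - x) <= B c by apply: Bmono => //; lra.
  lra.
(* if c < T, the estimate at c would extend phi <= B beyond c *)
suff cE : c = T.
  have [tc|tc] := ltP t c; first exact: below.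
  by rewrite (_ : t = c)//; apply/eqP; rewrite eq_le tc cE tT.
apply/eqP; rewrite eq_le cT leNgt; apply/negP => cltT.
have cI : 0 <= c <= T by rewrite c0.
have [d d0 Hd] := dphi c cI eta eta_gt0.
pose x := Num.min (d / 2) (T - c).
have x0 : 0 < x by rewrite lt_min divr_gt0// subr_gt0.
have xd : x < d.
  by apply: (@le_lt_trans _ _ (d / 2)); [rewrite /x !ge_min lexx | lra].
have xT : c + x <= T by rewrite -lerBrDl /x !ge_min lexx orbT.
suff : c + x <= c by lra.
apply: ub_le_sup; first exact: supA.2.
split; first by rewrite xT andbT addr_ge0// ltW.
move=> s /andP[s0 scx].
have [sc|cs] := ltP s c; first exact: below.
have sI : 0 <= s <= T by rewrite s0 (le_trans scx).
have ds : `|s - c| < d by rewrite ger0_norm ?subr_ge0//; lra.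
have := Hd s sI ds; rewrite (ger0_norm (_ : 0 <= s - c)) ?subr_ge0//.
rewrite ler_norml => /andP[_ ub].
apply: le_trans (Bgrow c s c0 cs).
have : (s - c) * (L * phi c) <= (s - c) * (L * B c).
  by rewrite ler_wpM2l ?subr_ge0// ler_wpM2l.
lra.
Qed.

(** * Euler points in a complete seminormed space *)

Lemma ler_geometric0 (R : realType) (x y c : R) :
  (forall n, x <= y + c * 2 ^- n) -> x <= y.
Proof.
move=> xy; apply/ler_addgt0Pr => e e0.
have [c0|c0] := leP c 0.
  by have := xy 0%N; rewrite expr0 invr1; lra.
pose n := Num.truncn (c / e).
have nce : c / e < 2 ^+ n.
  rewrite (lt_le_trans (truncnS_gt _))// -natrX ler_nat.
  exact: ltn_expl.
apply: (le_trans (xy n)); rewrite lerD2l ler_pdivrMr ?exprn_gt0//.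
by rewrite mulrC -ler_pdivrMr// ltW.
Qed.

Section seminormed_euler.
Context (R : realType) (E : lmodType R) (N : E -> R).
Hypothesis seminormD : forall u v, N (u + v) <= N u + N v.
Hypothesis seminormZ : forall (c : R) u, N (c *: u) = `|c| * N u.

Lemma seminorm0 : N 0 = 0.
Proof. by rewrite -(scale0r 0) seminormZ normr0 mul0r. Qed.

Lemma seminormN u : N (- u) = N u.
Proof. by rewrite -scaleN1r seminormZ normrN1 mul1r. Qed.

Lemma seminorm_ge0 u : 0 <= N u.
Proof.
have := seminormD u (- u); rewrite subrr seminorm0 seminormN -mulr2n.
by rewrite pmulrn_lge0.
Qed.

Lemma seminormB u v : N (u - v) = N (v - u).
Proof. by rewrite -seminormN opprB. Qed.

Lemma seminorm_triangle v u w : N (u - w) <= N (u - v) + N (v - w).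
Proof. by rewrite (le_trans _ (seminormD _ _))// addrA subrK. Qed.

Lemma seminorm_near u v : N u <= N v + N (u - v).
Proof. by rewrite (le_trans _ (seminormD _ _))// addrCA subrr addr0. Qed.

Context (F : E -> E) (L : R).
Hypothesis L_ge0 : 0 <= L.
Hypothesis F_lip : forall u v, N (F u - F v) <= L * N (u - v).

Definition euler_step (h : R) (u : E) : E := u + h *: F u.

Lemma euler_step_lip h u v : 0 <= h ->
  N (euler_step h u - euler_step h v) <= expR (h * L) * N (u - v).
Proof.
move=> h0; rewrite /euler_step opprD addrACA -scalerBr.
apply: (le_trans (seminormD _ _)); rewrite seminormZ ger0_norm//.
rewrite (@le_trans _ _ ((1 + h * L) * N (u - v)))//; last first.
  by rewrite ler_wpM2r ?seminorm_ge0 ?expR_ge1Dx.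
by rewrite mulrDl mul1r lerD2l -mulrA ler_wpM2l.
Qed.

Lemma expR_step (k : nat) h :
  expR (h * L) * expR (k%:R * h * L) = expR (k.+1%:R * h * L).
Proof. by rewrite -expRD; congr expR; rewrite -natr1; ring. Qed.

Lemma euler_iter_field k h u : 0 <= h ->
  N (F (iter k (euler_step h) u)) <= expR (k%:R * h * L) * N (F u).
Proof.
move=> h0; elim: k => [|k IH]; first by rewrite !mul0r expR0 mul1r.
rewrite iterS -expR_step -mulrA; set v := iter _ _ _ in IH *.
apply: (@le_trans _ _ (expR (h * L) * N (F v))); last first.
  by rewrite ler_wpM2l ?expR_ge0.
apply: (@le_trans _ _ ((1 + h * L) * N (F v))); last first.
  by rewrite ler_wpM2r ?seminorm_ge0 ?expR_ge1Dx.
rewrite (le_trans (seminorm_near _ (F v)))// mulrDl mul1r lerD2l.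
rewrite (le_trans (F_lip _ _))// /euler_step addrAC subrr add0r seminormZ.
by rewrite ger0_norm// mulrA (mulrC L).
Qed.

Lemma expR_stepS (k : nat) h : 0 <= h ->
  expR (k%:R * h * L) <= expR (k.+1%:R * h * L).
Proof.
move=> h0; rewrite ler_expR ler_wpM2r// ler_wpM2r// ler_nat.
exact: leqnSn.
Qed.

(** The displacement is a sum of k increments of size h, in each of which the
    field has been amplified by at most exp (khL). *)
Lemma euler_iter_dist k h u : 0 <= h ->
  N (iter k (euler_step h) u - u) <= k%:R * h * expR (k%:R * h * L) * N (F u).
Proof.
move=> h0; elim: k => [|k IH]; first by rewrite subrr seminorm0 !mul0r.
rewrite iterS; have := euler_iter_field k u h0.
set v := iter _ _ _ in IH * => Fv.
rewrite (le_trans (seminorm_triangle v _ _))//.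
rewrite /euler_step addrAC subrr add0r seminormZ ger0_norm//.
have e1 := expR_stepS k h0; have Fu := seminorm_ge0 (F u).
rewrite -natr1 in e1 *; set e := expR _ in e1 IH Fv *; set e' := expR _ in e1 *.
have k0 : 0 <= k%:R :> R by [].
have A : e * N (F u) <= e' * N (F u) by rewrite ler_wpM2r.
have B : h * N (F v) <= h * (e' * N (F u)).
  by rewrite ler_wpM2l// (le_trans Fv).
have C : k%:R * h * (e * N (F u)) <= k%:R * h * (e' * N (F u)).
  by rewrite ler_wpM2l// mulr_ge0.
lra.
Qed.

(** The discrete counterpart of the second-order Taylor bound: each step differs
    from h F u by h times the variation of F along the points already visited,
    which [euler_iter_dist] controls. *)
Lemma euler_iter_taylor k h u : 0 <= h ->
  N (iter k (euler_step h) u - u - (k%:R * h) *: F u) <=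
  L * (k%:R * h) ^+ 2 * expR (k%:R * h * L) * N (F u).
Proof.
move=> h0; elim: k => [|k IH].
  by rewrite subrr mul0r scale0r subrr seminorm0 expr0n/= mulr0 !mul0r.
rewrite iterS; have := euler_iter_dist k u h0.
set v := iter _ _ _ in IH * => vu.
have -> : euler_step h v - u - (k.+1%:R * h) *: F u =
    (v - u - (k%:R * h) *: F u) + h *: (F v - F u).
  rewrite /euler_step -natr1 mulrDl mul1r scalerDl scalerBr.
  by rewrite opprD !addrA -!(addrAC _ (h *: F v)).
rewrite (le_trans (seminormD _ _))// seminormZ ger0_norm//.
have FvFu := F_lip v u.
have e1 := expR_stepS k h0; have Fu := seminorm_ge0 (F u).
rewrite -natr1 in e1 *; set e := expR _ in e1 IH vu *; set e' := expR _ in e1 *.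
have k0 : 0 <= k%:R :> R by [].
have A : e * N (F u) <= e' * N (F u) by rewrite ler_wpM2r.
have P0 : 0 <= e' * N (F u) by rewrite mulr_ge0 ?expR_ge0.
set P := e' * N (F u) in A P0 *.
have B : h * N (F v - F u) <= h * (L * (k%:R * h * P)).
  rewrite ler_wpM2l// (le_trans FvFu)// ler_wpM2l// (le_trans vu)//.
  by rewrite -mulrA ler_wpM2l// mulr_ge0.
have C : L * (k%:R * h) ^+ 2 * (e * N (F u)) <= L * (k%:R * h) ^+ 2 * P.
  by rewrite ler_wpM2l// mulr_ge0// sqr_ge0.
have D : 0 <= L * h ^+ 2 * (k%:R + 1) * P.
  by apply: mulr_ge0 => //; rewrite !mulr_ge0 ?sqr_ge0 ?addr_ge0.
rewrite -[leRHS]mulrA -/P; lra.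
Qed.

(** One step of length h and two of length h / 2 differ by
    (h / 2) (F (u + (h / 2) F u) - F u), of order h^2; over k steps these
    defects are propagated with factor exp (hL) per step. *)
Lemma euler_refine k h u : 0 <= h ->
  N (iter k.*2 (euler_step (h / 2)) u - iter k (euler_step h) u) <=
  L * k%:R * h ^+ 2 * expR (k%:R * h * L) * N (F u).
Proof.
move=> h0; have h20 : 0 <= h / 2 by rewrite divr_ge0.
elim: k => [|k IH].
  by rewrite subrr seminorm0 mulr0 !mul0r.
rewrite doubleS !iterS; have := euler_iter_field k.*2 u h20.
have -> : k.*2%:R * (h / 2) = k%:R * h.
  by rewrite -muln2 natrM; field.
set v := iter k.*2 _ _ in IH *; set w := iter k _ _ in IH * => Fv.
rewrite (le_trans (seminorm_triangle (euler_step h v) _ _))//.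
have S1 := euler_step_lip v w h0.
have S2 : N (euler_step (h / 2) (euler_step (h / 2) v) - euler_step h v) <=
    L * h ^+ 2 * N (F v).
  have -> : euler_step (h / 2) (euler_step (h / 2) v) - euler_step h v =
      (h / 2) *: (F (euler_step (h / 2) v) - F v).
    set z := F (euler_step (h / 2) v).
    rewrite /euler_step -/(euler_step (h / 2) v) -/z scalerBr.
    have -> : h *: F v = (h / 2) *: F v + (h / 2) *: F v.
      by rewrite -scalerDl -splitr.
    by rewrite addrA [_ + _ *: z]addrC addrKA.
  rewrite seminormZ ger0_norm//.
  have := F_lip (euler_step (h / 2) v) v.
  rewrite {2}/euler_step addrAC subrr add0r seminormZ ger0_norm// => FL.
  have Fv0 := seminorm_ge0 (F v).
  rewrite (le_trans (ler_wpM2l h20 FL))//.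
  have : 0 <= L * h ^+ 2 * N (F v) by rewrite !mulr_ge0// sqr_ge0.
  lra.
have e1 := expR_stepS k h0; have Fu := seminorm_ge0 (F u).
have eS := expR_step k h.
rewrite -natr1 in e1 eS *; set e := expR (k%:R * _ * _) in e1 IH Fv eS *.
set e' := expR (_ * h * L) in e1 eS *.
set e0 := expR (h * L) in S1 eS *.
have B : L * h ^+ 2 * N (F v) <= L * h ^+ 2 * (e' * N (F u)).
  rewrite ler_wpM2l ?mulr_ge0 ?sqr_ge0// (le_trans Fv)//.
  by rewrite ler_wpM2r.
have C : e0 * N (v - w) <= e0 * (L * k%:R * h ^+ 2 * e * N (F u)).
  by rewrite ler_wpM2l ?expR_ge0.
rewrite -{}eS in B *; lra.
Qed.

(** The dyadic Euler point below time t, without interpolation: the grid error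
    is of the order of the step, hence vanishes in the limit. *)
Definition euler (n : nat) (g : E) (t : R) : E :=
  iter (Num.truncn (t * 2 ^+ n)) (euler_step (2 ^- n)) g.

Lemma euler_grid (n : nat) (t : R) : 0 <= t ->
  (Num.truncn (t * 2 ^+ n))%:R * 2 ^- n <= t <
  ((Num.truncn (t * 2 ^+ n))%:R + 1) * 2 ^- n.
Proof.
move=> t0; have t20 : 0 <= t * 2 ^+ n by rewrite mulr_ge0.
have /andP[kt tk] := truncn_itv t20.
by rewrite ler_pdivrMr ?exprn_gt0// kt ltr_pdivlMr ?exprn_gt0// natr1.
Qed.

Lemma truncn_double (x : R) : 0 <= x ->
  Num.truncn (x * 2) = (Num.truncn x).*2 \/
  Num.truncn (x * 2) = (Num.truncn x).*2.+1.
Proof.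
move=> x0; have /andP[kx xk] := truncn_itv x0.
have x20 : 0 <= x * 2 by rewrite mulr_ge0.
have [h|h] := ltP (x * 2) (Num.truncn x).*2.+1%:R; [left|right];
  apply: truncn_def; move: kx xk h; rewrite -!natr1 -muln2 natrM; lra.
Qed.

Lemma half_pow n : 2 ^- n.+1 = 2 ^- n / 2 :> R.
Proof. by rewrite exprS invfM mulrC. Qed.

(** Besides the refinement error, the finer grid may contain one more point
    below t, which costs one increment of length 2^-(n+1). *)
Lemma euler_cauchy n g t : 0 <= t ->
  N (euler n.+1 g t - euler n g t) <=
  (1 + L * t) * expR (t * L) * N (F g) * 2 ^- n.
Proof.
move=> t0; have /andP[kt _] := euler_grid n t0.
have h0 : 0 <= 2 ^- n :> R by rewrite invr_ge0 exprn_ge0.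
have h20 : 0 <= 2 ^- n / 2 :> R by rewrite divr_ge0.
rewrite /euler half_pow exprSr mulrA.
have t2 : 0 <= t * 2 ^+ n by rewrite mulr_ge0.
have := truncn_double t2.
set k := Num.truncn (t * 2 ^+ n) in kt *.
set h := 2 ^- n in kt h0 h20 *.
have k0 : 0 <= k%:R :> R by [].
have Fg := seminorm_ge0 (F g).
have eP : expR (k%:R * h * L) <= expR (t * L) by rewrite ler_expR ler_wpM2r.
have EN : expR (k%:R * h * L) * N (F g) <= expR (t * L) * N (F g).
  by rewrite ler_wpM2r.
have A := euler_refine k g h0.
have B : N (iter k.*2 (euler_step (h / 2)) g - iter k (euler_step h) g) <=
    L * t * h * (expR (t * L) * N (F g)).
  apply: (le_trans A); rewrite -mulrA.
  apply: (@le_trans _ _ (L * k%:R * h ^+ 2 * (expR (t * L) * N (F g)))).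
    by rewrite ler_wpM2l// !mulr_ge0.
  rewrite ler_wpM2r ?mulr_ge0 ?expR_ge0//.
  rewrite -!mulrA ler_wpM2l// expr2 mulrA ler_wpM2r//.
have C0 : 0 <= h * (expR (t * L) * N (F g)) by rewrite !mulr_ge0 ?expR_ge0.
have G : k.*2%:R * (h / 2) = k%:R * h by rewrite -muln2 natrM; field.
case=> ->; first by lra.
rewrite iterS.
rewrite (le_trans (seminorm_triangle (iter k.*2 (euler_step (h / 2)) g) _ _))//.
have := euler_iter_field k.*2 g h20; rewrite G; set v := iter _ _ _ => Fv.
rewrite {1}/euler_step addrAC subrr add0r seminormZ ger0_norm//.
have D : h / 2 * N (F v) <= h / 2 * (expR (t * L) * N (F g)).
  by rewrite ler_wpM2l// (le_trans Fv).
rewrite -/v in B; lra.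
Qed.

(** Between the grid points below t and below s the scheme makes m steps with
    |m 2^-n - (s - t)| <= 2^-n. *)
Lemma euler_taylor n g s t T : 0 <= t -> t <= s -> s <= T ->
  N (euler n g s - euler n g t - (s - t) *: F (euler n g t)) <=
  (L * (s - t + 2 ^- n) ^+ 2 + 2 ^- n) *
    (expR ((s - t + 1) * L) * (expR (T * L) * N (F g))).
Proof.
move=> t0 ts sT; have s0 := le_trans t0 ts.
have /andP[kt tk] := euler_grid n t0; have /andP[ks sk] := euler_grid n s0.
have h0 : 0 <= 2 ^- n :> R by rewrite invr_ge0 exprn_ge0.
have h1 : 2 ^- n <= 1 :> R by rewrite invf_le1 ?exprn_gt0// exprn_ege1// ler1n.
have jk : (Num.truncn (t * 2 ^+ n) <= Num.truncn (s * 2 ^+ n))%N.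
  by rewrite le_truncn// ler_wpM2r// exprn_ge0.
rewrite /euler in jk kt tk ks sk *.
rewrite -{1}(subnK jk) iterD.
have := natrB R jk.
set j := Num.truncn (t * 2 ^+ n) in jk kt tk *.
set k := Num.truncn (s * 2 ^+ n) in jk ks sk *.
set m := (k - j)%N => mE.
set h := 2 ^- n in h0 h1 kt tk ks sk *.
have m0 : 0 <= m%:R :> R by [].
have := euler_iter_field j g h0; set v := iter j _ _ => Fv.
have := euler_iter_taylor m v h0; set w := iter m _ _ => A.
have mh1 : m%:R * h <= s - t + h by rewrite mE; lra.
have mh2 : s - t - h <= m%:R * h by rewrite mE; lra.
have -> : w - v - (s - t) *: F v =
    (w - v - (m%:R * h) *: F v) + (m%:R * h - (s - t)) *: F v.
  by rewrite [(_ * _ - _) *: _]scalerBl addrA subrK.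
rewrite (le_trans (seminormD _ _))// seminormZ.
have B : `|m%:R * h - (s - t)| <= h.
  by rewrite ler_norml; apply/andP; split; lra.
have Fg := seminorm_ge0 (F g); have Fv0 := seminorm_ge0 (F v).
have FvT : N (F v) <= expR (T * L) * N (F g).
  rewrite (le_trans Fv)// ler_wpM2r// ler_expR ler_wpM2r//.
  by rewrite (le_trans kt)// (le_trans ts).
have e1 : expR (m%:R * h * L) <= expR ((s - t + 1) * L).
  by rewrite ler_expR ler_wpM2r//; lra.
have e2 : 1 <= expR ((s - t + 1) * L).
  by rewrite -expR0 ler_expR mulr_ge0// addr_ge0 // subr_ge0.
set Q := expR (T * L) * N (F g) in FvT *.
set e := expR ((s - t + 1) * L) in e1 e2 *.
have eQ : N (F v) <= e * Q.
  by rewrite (le_trans FvT)// ler_peMl// mulr_ge0 ?expR_ge0.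
have eQ' : expR (m%:R * h * L) * N (F v) <= e * Q by rewrite ler_pM ?expR_ge0.
have eQ0 : 0 <= e * Q by rewrite (le_trans _ eQ).
rewrite mulrDl lerD//; last by rewrite ler_pM.
rewrite (le_trans A)// -mulrA ler_pM ?mulr_ge0 ?sqr_ge0 ?expR_ge0//.
rewrite ler_wpM2l// ler_sqr ?nnegrE//.
  exact: mulr_ge0.
by rewrite addr_ge0// subr_ge0.
Qed.

(** Completeness in the form suited to the Euler points, whose increments are
    geometric: the bound on the distance to the limit is what makes their
    convergence uniform in time. *)
Hypothesis complete : forall (u : nat -> E) (C : R),
  (forall n, N (u n.+1 - u n) <= C * 2 ^- n) ->
  exists l, forall n, N (u n - l) <= 2 * C * 2 ^- n.

Lemma euler_limit g : exists y : R -> E, forall T, 0 <= T ->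
  exists C, forall t n, 0 <= t <= T -> N (euler n g t - y t) <= C * 2 ^- n.
Proof.
have lim t : exists l, 0 <= t -> forall n, N (euler n g t - l) <=
    2 * ((1 + L * t) * expR (t * L) * N (F g)) * 2 ^- n.
  have [t0|t0] := leP 0 t; last by exists 0.
  have [l Hl] := complete (fun n => euler_cauchy n g t0).
  by exists l.
have [y Hy] := choice lim; exists y => T T0.
exists (2 * ((1 + L * T) * expR (T * L) * N (F g))) => t n /andP[t0 tT].
rewrite (le_trans (Hy t t0 n))// ler_wpM2r ?invr_ge0 ?exprn_ge0//.
rewrite ler_wpM2l// ler_wpM2r ?seminorm_ge0//.
rewrite ler_pM ?expR_ge0 ?addr_ge0 ?mulr_ge0 ?ler_expR ?ler_wpM2r//.
by rewrite lerD2l ler_wpM2l.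
Qed.

(** The quadratic bound on the defect is the form in which the equation is
    solved: it contains differentiability, y' = F y and local Lipschitz
    continuity, at interior points and end points alike. *)
Lemma solution_exists g : exists y : R -> E, N (y 0 - g) = 0 /\
  forall T, 0 <= T -> exists C, forall s t, 0 <= s <= T -> 0 <= t <= T ->
    N (y s - y t - (s - t) *: F (y t)) <= C * (s - t) ^+ 2.
Proof.
have [y Hy] := euler_limit g; exists y; split.
  apply/eqP; rewrite eq_le seminorm_ge0 andbT.
  have [C HC] := Hy 0 (lexx _).
  apply: (@ler_geometric0 _ _ _ C) => n; rewrite add0r seminormB.
  have := HC 0 n; rewrite lexx => /(_ isT).
  by rewrite /euler mul0r truncn0.
move=> T T0; have [D HD] := Hy T T0.
pose P := expR ((T + 1) * L) * (expR (T * L) * N (F g)).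
have P0 : 0 <= P by rewrite !mulr_ge0 ?expR_ge0 ?seminorm_ge0.
have D0 : 0 <= D.
  have := HD 0 0%N; rewrite lexx T0 expr0 invr1 mulr1 => /(_ isT).
  by apply: le_trans; exact: seminorm_ge0.
(* for t <= s the estimate is the limit of [euler_taylor] *)
have fwd s t : 0 <= t -> t <= s -> s <= T ->
    N (y s - y t - (s - t) *: F (y t)) <= L * P * (s - t) ^+ 2.
  move=> t0 ts sT; have st0 : 0 <= s - t by rewrite subr_ge0.
  apply: (@ler_geometric0 _ _ _
    (D + D + (s - t) * (L * D) + (L * (2 * (s - t) + 1) + 1) * P)) => n.
  have A := @euler_taylor n g s t T t0 ts sT.
  have s0 := le_trans t0 ts; have tT := le_trans ts sT.
  have Bs : N (euler n g s - y s) <= D * 2 ^- n by apply: HD; rewrite s0.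
  have Bt : N (euler n g t - y t) <= D * 2 ^- n by apply: HD; rewrite t0.
  have h0 : 0 <= 2 ^- n :> R by rewrite invr_ge0 exprn_ge0.
  have h1 : 2 ^- n <= 1 :> R.
    by rewrite invf_le1 ?exprn_gt0// exprn_ege1// ler1n.
  set h := 2 ^- n in A Bs Bt h0 h1 *.
  set u := euler n g s in A Bs; set v := euler n g t in A Bt.
  have -> : y s - y t - (s - t) *: F (y t) =
      (y s - u) + ((u - v - (s - t) *: F v +
        (s - t) *: (F v - F (y t))) + (v - y t)).
    rewrite [_ *: (_ - _)]scalerBr subrKA [u - v - _]addrAC subrKA.
    by rewrite -[u - _ - _]addrA subrKA addrA addrAC.
  rewrite (le_trans (seminormD _ _))//.
  have P1 : expR ((s - t + 1) * L) * (expR (T * L) * N (F g)) <= P.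
    rewrite ler_wpM2r ?mulr_ge0 ?expR_ge0 ?seminorm_ge0// ler_expR.
    by rewrite ler_wpM2r//; lra.
  have A' := le_trans A (ler_wpM2l _ P1).
  have {A'}A : N (u - v - (s - t) *: F v) <= (L * (s - t + h) ^+ 2 + h) * P.
    by apply: A'; rewrite addr_ge0// mulr_ge0// sqr_ge0.
  set q := _ *: (F v - _).
  have B1 := seminormD (u - v - (s - t) *: F v + q) (v - y t).
  have B2 := seminormD (u - v - (s - t) *: F v) q.
  rewrite [in X in _ <= X]seminormZ (ger0_norm st0) -/q in B2.
  rewrite seminormB in Bs.
  have B3 : (s - t) * N (F v - F (y t)) <= (s - t) * (L * (D * h)).
    by rewrite ler_wpM2l// (le_trans (F_lip _ _))// ler_wpM2l.
  have hh : h ^+ 2 <= h by rewrite expr2 ler_piMl.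
  have LP0 : 0 <= L * P by rewrite mulr_ge0.
  have B4 : L * P * h ^+ 2 <= L * P * h by rewrite ler_wpM2l.
  lra.
have LP0 : 0 <= L * P by rewrite mulr_ge0.
have growth s : 0 <= s <= T ->
    N (y s - y 0) <= L * P * T ^+ 2 + T * N (F (y 0)).
  move=> /andP[s0 sT]; have := fwd s 0 (lexx _) s0 sT; rewrite subr0 => A.
  rewrite (le_trans (seminorm_near _ (s *: F (y 0))))// [leLHS]addrC lerD//.
    by rewrite (le_trans A)// ler_wpM2l// ler_sqr.
  by rewrite seminormZ ger0_norm// ler_wpM2r ?seminorm_ge0.
pose M := N (F (y 0)) + L * (L * P * T ^+ 2 + T * N (F (y 0))).
have field_le s : 0 <= s <= T -> N (F (y s)) <= M.
  move=> sT; rewrite (le_trans (seminorm_near _ (F (y 0))))// lerD2l.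
  by rewrite (le_trans (F_lip _ _))// ler_wpM2l// growth.
have M0 : 0 <= M by rewrite (le_trans (seminorm_ge0 _) (field_le 0 _))// lexx.
exists (L * P + L * (L * P * T + M)) => s t /andP[s0 sT] /andP[t0 tT].
have [ts|st] := leP t s.
  rewrite (le_trans (fwd s t t0 ts sT))// ler_wpM2r ?sqr_ge0// lerDl.
  by rewrite mulr_ge0// addr_ge0// mulr_ge0.
(* for s < t, expand at the earlier time s and replace F (y s) by F (y t) *)
have ts0 : 0 <= t - s by rewrite subr_ge0 ltW.
have A := fwd t s s0 (ltW st) tT.
have -> : y s - y t - (s - t) *: F (y t) =
    - (y t - y s - (t - s) *: F (y s)) + (t - s) *: (F (y t) - F (y s)).
  rewrite !opprB -[s - t]opprB scaleNr opprK scalerBr.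
  by rewrite [RHS]addrC subrKA addrC.
rewrite (le_trans (seminormD _ _))// seminormN seminormZ ger0_norm//.
have Fs : N (F (y s)) <= M by rewrite field_le// s0.
have yts : N (y t - y s) <= (t - s) * (L * P * T + M).
  rewrite (le_trans (seminorm_near _ ((t - s) *: F (y s))))//.
  rewrite seminormZ ger0_norm//.
  have : (t - s) * N (F (y s)) <= (t - s) * M by rewrite ler_wpM2l.
  have : L * P * (t - s) * (t - s) <= L * P * T * (t - s).
    by rewrite ler_wpM2r// ler_wpM2l//; lra.
  lra.
have Fts : (t - s) * N (F (y t) - F (y s)) <=
    (t - s) * (L * ((t - s) * (L * P * T + M))).
  by rewrite ler_wpM2l// (le_trans (F_lip _ _))// ler_wpM2l.
lra.
Qed.

(** Differentiability with y' = F y, relative to the interval [0, T] and modulo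
    N. *)
Definition solves (T : R) (x : R -> E) := forall t, 0 <= t <= T ->
  forall e, 0 < e -> exists2 d, 0 < d & forall s, 0 <= s <= T ->
    `|s - t| < d -> N (x s - x t - (s - t) *: F (x t)) <= e * `|s - t|.

(** The distance of two solutions satisfies the hypothesis of [gronwall]: the
    two derivatives differ by at most L times that distance. *)
Lemma solves_stable T x z : solves T x -> solves T z ->
  forall t, 0 <= t <= T -> N (x t - z t) <= N (x 0 - z 0) * expR (L * t).
Proof.
move=> Sx Sz; apply: (gronwall L_ge0) => [t _|t tT e e0].
  exact: seminorm_ge0.
have e20 : 0 < e / 2 by rewrite divr_gt0.
have [d1 d10 H1] := Sx t tT _ e20; have [d2 d20 H2] := Sz t tT _ e20.
exists (Num.min d1 d2) => [|s sT]; first by rewrite lt_min d10.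
rewrite lt_min => /andP[sd1 sd2].
have {}H1 := H1 s sT sd1; have {}H2 := H2 s sT sd2.
set a := x s - x t - _ in H1; set b := z s - z t - _ in H2.
have incr : N (x s - z s - (x t - z t)) <=
    `|s - t| * (L * N (x t - z t) + e).
  have -> : x s - z s - (x t - z t) =
      (a - b) + (s - t) *: (F (x t) - F (z t)).
    rewrite scalerBr /a /b; set p := _ *: F (x t); set q := _ *: F (z t).
    rewrite (opprB (z s - z t)) [RHS]addrC [x s - _ - p + _]addrC addrA subrKA.
    by rewrite addrC subrKA !opprD !opprK addrACA.
  rewrite (le_trans (seminormD _ _))// seminormZ.
  have ab : N (a - b) <= N a + N b.
    by rewrite (le_trans (seminormD _ _))// seminormN.
  have FL := ler_wpM2l (normr_ge0 (s - t)) (F_lip (x t) (z t)).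
  lra.
rewrite ler_norml; apply/andP; split.
  have := seminorm_near (x t - z t) (x s - z s).
  rewrite seminormB in incr.
  lra.
have := seminorm_near (x s - z s) (x t - z t).
lra.
Qed.

(** A solution remains one when each value is replaced by a vector at distance
    0, here another representative of the same class. *)
Lemma null_perturbation (y z : R -> E) : (forall t, N (z t - y t) = 0) ->
  forall s t, N (z s - z t - (s - t) *: F (z t)) <=
              N (y s - y t - (s - t) *: F (y t)).
Proof.
move=> zy s t.
have -> : z s - z t - (s - t) *: F (z t) = (y s - y t - (s - t) *: F (y t)) +
    (z s - y s + (y t - z t) + (s - t) *: (F (y t) - F (z t))).
  rewrite [in RHS]scalerBr addrACA addKr; congr (_ - _).
  by rewrite addrACA addKr subrKC.
have Fzy : N (F (y t) - F (z t)) = 0.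
  apply/eqP; rewrite eq_le seminorm_ge0 andbT.
  by rewrite (le_trans (F_lip _ _))// seminormB zy mulr0.
rewrite (le_trans (seminormD _ _))// gerDl.
rewrite (le_trans (seminormD _ _))// seminormZ Fzy mulr0 addr0.
by rewrite (le_trans (seminormD _ _))// zy seminormB zy addr0.
Qed.

End seminormed_euler.

(** * Completeness of L^q *)

Lemma limn_einf_ge0 (R : realType) (u : (\bar R)^nat) :
  (forall n, (0 <= u n)%E) -> (0 <= limn_einf u)%E.
Proof.
move=> u0; rewrite limn_einf_lim; apply: lime_ge; first exact: is_cvg_einfs.
by apply: nearW => n; apply/ereal_infP => _ [k _ <-].
Qed.

Lemma limn_einf_le (R : realType) (u : (\bar R)^nat) (c : \bar R) (n : nat) :
  (forall m, (n <= m)%N -> (u m <= c)%E) -> (limn_einf u <= c)%E.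
Proof.
move=> uc; rewrite limn_einf_lim; apply: lime_le; first exact: is_cvg_einfs.
exists n => // m /= nm; apply: le_trans (uc m nm).
by apply: ereal_inf_lbound; exists m => //=.
Qed.

(** For use with Fatou's lemma. At a = 0 it holds by positivity, elsewhere by
    continuity of the power. *)
Lemma powR_lsc (R : realType) (q : R) (u : R^nat) (a : R) : 0 < q ->
  (forall n, 0 <= u n) -> 0 <= a -> u n @[n --> \oo] --> a ->
  ((a `^ q)%:E <= limn_einf (fun n => (u n `^ q)%:E))%E.
Proof.
move=> q0 u0; rewrite le_eqVlt => /predU1P[<- _|a0 ua].
  rewrite powR0 ?gt_eqF//; apply: limn_einf_ge0 => n.
  by rewrite lee_fin powR_ge0.
suff /cvg_limn_einf_sup[-> _] : (u n `^ q)%:E @[n --> \oo] --> (a `^ q)%:E.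
  exact: lexx.
apply: cvg_EFin; first by apply: nearW.
have lnu : expR (q * ln (u n)) @[n --> \oo] --> a `^ q.
  rewrite /powR gt_eqF//; apply: continuous_cvg; first exact: continuous_expR.
  apply: cvgMl_tmp; apply: continuous_cvg => //; exact: continuous_ln.
apply: cvg_trans lnu; apply: near_eq_cvg.
have [n _ Hn] := cvgr_gt a ua _ a0.
by exists n => // m /= nm; rewrite /powR gt_eqF//; exact: Hn.
Qed.

Lemma nneseries_lty_cvg (R : realType) (v : R^nat) :
  (\sum_(0 <= n <oo) `|v n|%:E < +oo)%E -> cvgn (series v).
Proof.
move=> voo; apply: normed_cvg; apply: nondecreasing_is_cvgn.
  by apply: (@nondecreasing_series _ _ xpredT) => n _ _; exact: normr_ge0.
have s0 : (0 <= \sum_(0 <= n <oo) `|v n|%:E)%E.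
  by apply: nneseries_ge0 => n _ _; rewrite lee_fin.
exists (fine (\sum_(0 <= n <oo) `|v n|%:E)) => _ [n _ <-].
rewrite -lee_fin fineK ?ge0_fin_numE// /series/= -sumEFin.
by apply: (nneseries_lim_ge n) => k _ _; rewrite lee_fin.
Qed.

Lemma measurable_fun_limn_einf d (T : measurableType d) (R : realType)
    (f : (T -> \bar R)^nat) : (forall n, measurable_fun setT (f n)) ->
  measurable_fun setT (fun x => limn_einf (f ^~ x)).
Proof.
move=> mf.
rewrite (_ : (fun x => _) = (fun x => - limn_esup (fun n => - f n x))%E).
  apply: measurableT_comp => //; apply: measurable_fun_limn_esup => n.
  exact: measurableT_comp.
apply/funext => x; rewrite -limn_einfN; congr limn_einf.
by apply/funext => n /=; rewrite oppeK.
Qed.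

Section Lq_seminorm.
Context d (T : measurableType d) (R : realType).
Context (mu : {measure set T -> \bar R}) (q : R) (q1 : (1 <= q%:E)%E).

Local Notation E := (LfunType mu q1).

Definition Lq_seminorm (u : E) : R := fine 'N[mu]_q%:E[EFin \o u].

Let q_gt0 : 0 < q.
Proof. by rewrite -lte_fin (lt_le_trans _ q1). Qed.

Lemma Lq_seminormE (u : E) : (Lq_seminorm u)%:E = 'N[mu]_q%:E[EFin \o u]%E.
Proof. exact: finite_norm_fine. Qed.

Lemma Lq_seminormD (u v : E) :
  Lq_seminorm (u + v) <= Lq_seminorm u + Lq_seminorm v.
Proof. exact: ler_LnormD. Qed.

Lemma Lq_seminormZ (c : R) (u : E) :
  Lq_seminorm (c *: u) = `|c| * Lq_seminorm u.
Proof. by apply/EFin_inj; rewrite EFinM !Lq_seminormE -LnormZ. Qed.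

Lemma Lq_seminorm_ge0 (u : E) : 0 <= Lq_seminorm u.
Proof. by rewrite fine_ge0// Lnorm_ge0. Qed.

Lemma Lfun_measurable (u : E) : measurable_fun setT (u : T -> R).
Proof. exact: measurable_funP. Qed.

Lemma measurable_powRq (f : T -> R) : measurable_fun setT f ->
  measurable_fun setT (fun x => `|f x| `^ q).
Proof.
move=> mf.
apply: (@measurableT_comp _ _ _ _ _ _ (@powR R ^~ q)) => //.
exact: measurableT_comp.
Qed.

Lemma Lnorm_powRE (f : T -> R) :
  ('N[mu]_q%:E[EFin \o f] `^ q = \int[mu]_x (`|f x| `^ q)%:E)%E.
Proof. by rewrite poweR_Lnorm ?gt_eqF. Qed.

Lemma Lnorm_lty_integral (f : T -> R) :
  (\int[mu]_x (`|f x| `^ q)%:E < +oo)%E -> ('N[mu]_q%:E[EFin \o f] < +oo)%E.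
Proof. by rewrite -Lnorm_powRE; apply: lty_poweRy; rewrite gt_eqF. Qed.

Lemma le_Lnorm_powR (f : T -> R) (c : R) : 0 <= c ->
  (\int[mu]_x (`|f x| `^ q)%:E <= (c `^ q)%:E)%E ->
  ('N[mu]_q%:E[EFin \o f] <= c%:E)%E.
Proof.
move=> c0 fc; have fin := Lnorm_lty_integral (le_lt_trans fc (ltry _)).
move: fc; rewrite -Lnorm_powRE -poweR_EFin.
have := Lnorm_ge0 mu q%:E (EFin \o f).
case: ('N[mu]_q%:E[EFin \o f])%E fin => //= r _; rewrite !lee_fin => r0.
move=> rc; rewrite leNgt; apply/negP => cr.
have : c `^ q < r `^ q by rewrite gt0_ltr_powR// nnegrE.
by rewrite ltNge rc.
Qed.

Lemma le_Lnorm (f g : T -> R) :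
  measurable_fun setT f -> measurable_fun setT g ->
  (forall x, `|f x| <= `|g x|) ->
  ('N[mu]_q%:E[EFin \o f] <= 'N[mu]_q%:E[EFin \o g])%E.
Proof.
move=> mf mg fg.
have := Lnorm_ge0 mu q%:E (EFin \o g).
have := Lnorm_powRE g; case: ('N[mu]_q%:E[EFin \o g])%E => [c| |]//.
  rewrite lee_fin poweR_EFin => gE c0; apply: le_Lnorm_powR => //; rewrite gE.
  apply: ge0_le_integral => //.
  - exact/measurable_EFinP/measurable_powRq.
  - exact/measurable_EFinP/measurable_powRq.
  - by move=> x _; rewrite lee_fin ge0_ler_powR// ltW.
by move=> _ _; rewrite leey.
Qed.

Lemma ae_eq_Lnorm (f g : T -> R) : measurable_fun setT f ->
  measurable_fun setT g -> {ae mu, forall x, f x = g x} ->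
  'N[mu]_q%:E[EFin \o f]%E = 'N[mu]_q%:E[EFin \o g]%E.
Proof.
move=> mf mg fg; rewrite unlock; congr (_ `^ _)%E.
apply: ae_eq_integral => //.
- exact/measurable_EFinP/measurable_powRq.
- exact/measurable_EFinP/measurable_powRq.
- by apply: filterS fg => y /= -> _.
Qed.

(** Hoelder's inequality against the constant 1: on a probability space the
    L^1 norm is bounded by the L^q norm. *)
Lemma L1norm_le_Lnorm (f : T -> R) : mu setT = 1%E ->
  measurable_fun setT f ->
  (\int[mu]_x `|(f x)%:E| <= 'N[mu]_q%:E[EFin \o f])%E.
Proof.
move=> mu1 mf; rewrite -(Lnorm1 mu (EFin \o f)).
move: q1; rewrite lee_fin le_eqVlt => /predU1P[<-//|ltq].
have q'0 : 0 < 1 - q^-1 by rewrite subr_gt0 invf_lt1.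
have conj : q^-1 + (1 - q^-1)^-1^-1 = 1 by rewrite invrK addrC subrK.
have c0 : 0 < (1 - q^-1)^-1 by rewrite invr_gt0.
have m1 : measurable_fun [set: T] (cst (1 : R)) by exact: measurable_cst.
have := hoelder mu mf m1 q_gt0 c0 conj.
rewrite Lnorm_cst1 mu1 poweR_EFin powR1 mule1.
by rewrite (_ : f \* cst 1 = f)%R//; apply/funext => x /=; rewrite mulr1.
Qed.

Lemma Lq_seminorm_eq0 (u v : E) :
  Lq_seminorm (u - v) = 0 <-> {ae mu, forall x, u x = v x}.
Proof.
split=> [/(@fine_Lnormr_eq0 _ _ _ mu _ q1)|uv].
  apply: filterS => x /(_ Logic.I) /= uvx.
  by apply/eqP; rewrite -subr_eq0 -[0]uvx.
apply/EFin_inj; rewrite Lq_seminormE.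
have N0 : 'N[mu]_q%:E[EFin \o cst 0%R]%E = 0%E.
  by apply: Lnorm0; rewrite gt_eqF.
apply: etrans N0; apply: ae_eq_Lnorm.
- exact: Lfun_measurable.
- exact: measurable_cst.
apply: filterS uv => x /= uvx.
by rewrite -[LHS]/(u x - v x) uvx subrr.
Qed.

Lemma Lq_seminorm_tail (u : nat -> E) C :
  (forall n, Lq_seminorm (u n.+1 - u n) <= C * 2 ^- n) ->
  forall n k, Lq_seminorm (u n - u (n + k)%N) <=
              2 * C * 2 ^- n * (1 - 2 ^- k).
Proof.
move=> uC n; elim=> [|k IH].
  rewrite addn0 subrr expr0 invr1 subrr mulr0.
  by rewrite (seminorm0 Lq_seminormZ).
rewrite addnS.
apply: (le_trans (seminorm_triangle Lq_seminormD (u (n + k)%N) _ _)).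
have uk := uC (n + k)%N; rewrite (seminormB Lq_seminormZ) in uk.
apply: (le_trans (lerD IH uk)).
rewrite exprD exprS !invfM; set a := 2 ^- n; set b := 2 ^- k; lra.
Qed.

(** On a probability space the increments are also summable in L^1, so that
    their absolute values have an almost everywhere finite sum and the sequence
    converges almost everywhere. *)
Theorem Lq_complete (u : nat -> E) C : mu setT = 1%E ->
  (forall n, Lq_seminorm (u n.+1 - u n) <= C * 2 ^- n) ->
  exists l : E, forall n, Lq_seminorm (u n - l) <= 2 * C * 2 ^- n.
Proof.
move=> mu1 uC.
have C0 : 0 <= C.
  have := uC 0%N; rewrite expr0 invr1 mulr1; apply: le_trans.
  exact: Lq_seminorm_ge0.
pose v n x := u n.+1 x - u n x.
have mv n : measurable_fun setT (v n).
  by apply: measurable_funB; exact: Lfun_measurable.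
have mav n : measurable_fun setT (fun x => `|v n x|%:E).
  by apply/measurable_EFinP; exact: measurableT_comp.
have sum_fin : (\int[mu]_x (\sum_(0 <= n <oo) `|v n x|%:E) < +oo)%E.
  rewrite integral_nneseries//.
  apply: (@le_lt_trans _ _ (\sum_(0 <= n <oo) (2 * C / (2 ^ (n + 1))%:R)%:E)%E).
    apply: lee_nneseries => [n _ _|n _]; first by apply: integral_ge0.
    apply: (le_trans (L1norm_le_Lnorm mu1 (mv n))).
    rewrite -[leLHS](Lq_seminormE (u n.+1 - u n)) lee_fin (le_trans (uC n))//.
    by rewrite natrX addn1 exprS invfM; lra.
  have /cvg_lim := @cvg_geometric_eseries_half R (2 * C) 0.
  by rewrite /eseries/= => ->//; rewrite ltry.
have cvg_ae : {ae mu, forall x, cvgn (fun n => u n x)}.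
  have : mu.-integrable setT (fun x => \sum_(0 <= n <oo) `|v n x|%:E)%E.
    apply/integrableP; split.
      by apply: ge0_emeasurable_sum => // n x _ _; rewrite lee_fin.
    under eq_integral do rewrite gee0_abs ?nneseries_ge0//.
    exact: sum_fin.
  move=> /(integrable_ae measurableT); apply: filterS => x /(_ I) fx.
  have vx : cvgn (series (v ^~ x)).
    by apply: nneseries_lty_cvg; rewrite -ge0_fin_numE ?nneseries_ge0.
  have -> : (fun n => u n x) = cst (u 0%N x) \+ series (v ^~ x).
    by apply/funext => n /=; rewrite [LHS](eq_sum_telescope (fun n => u n x)).
  by apply: is_cvgD => //; exact: is_cvg_cst.
(* the upper limit is measurable and equals the limit where there is one *)
pose lf x := fine (limn_esup (fun n => (u n x)%:E)).
have mlf : measurable_fun setT lf.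
  apply: (measurableT_comp (fine_measurable measurableT)).
  apply: measurable_fun_limn_esup => n; apply/measurable_EFinP.
  exact: Lfun_measurable.
have lf_cvg : {ae mu, forall x, u n x @[n --> \oo] --> lf x}.
  apply: filterS cvg_ae => x ux.
  have eux : (u n x)%:E @[n --> \oo] --> (limn (fun n => u n x))%:E.
    by apply: cvg_EFin; [exact: nearW | exact: ux].
  by rewrite /lf; have [_ ->] := cvg_limn_einf_sup eux.
have bound n : ('N[mu]_q%:E[EFin \o (fun x => u n x - lf x)%R] <=
    (2 * C * 2 ^- n)%:E)%E.
  have c0 : 0 <= 2 * C * 2 ^- n by rewrite !mulr_ge0// invr_ge0 exprn_ge0.
  apply: le_Lnorm_powR => //.
  have mum m : measurable_fun setT (fun x => u n x - u m x).
    by apply: measurable_funB; exact: Lfun_measurable.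
  apply: (@le_trans _ _ (\int[mu]_x limn_einf
      (fun m => (`|u n x - u m x| `^ q)%:E))%E).
    apply: ae_ge0_le_integral => //.
    - by apply/measurable_EFinP/measurable_powRq; apply: measurable_funB => //;
        exact: Lfun_measurable.
    - by move=> x _; apply: limn_einf_ge0 => m; rewrite lee_fin powR_ge0.
    - apply: measurable_fun_limn_einf => m.
      by apply/measurable_EFinP/measurable_powRq.
    apply: filterS lf_cvg => x ulx _; apply: powR_lsc => //.
    apply: cvg_norm; apply: cvgB => //; exact: cvg_cst.
  apply: (le_trans (fatou mu measurableT _ _)).
  - by move=> m; apply/measurable_EFinP/measurable_powRq.
  - by move=> m x _; rewrite lee_fin powR_ge0.
  apply: (@limn_einf_le _ _ _ n) => m nm.
  rewrite -Lnorm_powRE -[X in (X `^ _)%E](Lq_seminormE (u n - u m)).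
  rewrite poweR_EFin lee_fin ge0_ler_powR ?nnegrE//.
  - exact: ltW.
  - exact: Lq_seminorm_ge0.
  rewrite -(subnKC nm) (le_trans (Lq_seminorm_tail uC n (m - n)))//.
  rewrite ler_piMr// lerBlDr lerDl invr_ge0 exprn_ge0//.
have lfL : lf \in Lfun mu q%:E.
  rewrite inE; apply/andP; split; rewrite inE//= /finite_norm.
  have : ('N[mu]_q%:E[EFin \o lf] <=
      'N[mu]_q%:E[EFin \o (fun x => lf x - u 0%N x)%R] +
      'N[mu]_q%:E[EFin \o u 0%N])%E.
    have mlu : measurable_fun setT (fun x => lf x - u 0%N x).
      by apply: measurable_funB => //; exact: Lfun_measurable.
    have := minkowski_EFin mu mlu (Lfun_measurable (u 0%N)) q1.
    rewrite (_ : _ \+ u 0%N = lf)//.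
    by apply/funext => x /=; rewrite subrK.
  move=> /le_lt_trans; apply; rewrite lte_add_pinfty//.
    apply: le_lt_trans (ltry (2 * C * 2 ^- 0)); apply: le_trans (bound 0%N).
    rewrite -(oppe_Lnorm _ (EFin \o (fun x => u 0%N x - lf x)%R)).
    by rewrite (_ : \- _ = EFin \o (fun x => lf x - u 0%N x)%R)%E//;
      apply/funext => x /=; rewrite opprB.
  exact: Lfunction_finite.
exists (Lfun_Sub q1 lfL) => n; rewrite -lee_fin Lq_seminormE.
exact: bound.
Qed.

End Lq_seminorm.

(** * Lipschitz integral operators on L^q *)

Lemma lipschitz2_ge0 (R : realType) (G : R -> R -> R) (K : R) :
  (forall u v u' v', `|G u v - G u' v'| <= K * (`|u - u'| + `|v - v'|)) ->
  0 <= K.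
Proof.
move=> /(_ 1 0 0 0); rewrite !subr0 normr0 addr0 normr1 mulr1.
exact: le_trans.
Qed.

(** G (g, h) < c exactly when some pair of rationals (r, s) satisfies
    G (r, s) + K (|g - r| + |h - s|) < c, which exhibits the sublevel set as a
    countable union of measurable sets. *)
Lemma measurable_lipschitz2_comp d (T : measurableType d) (R : realType)
    (G : R -> R -> R) (K : R) (g h : T -> R) :
  (forall u v u' v', `|G u v - G u' v'| <= K * (`|u - u'| + `|v - v'|)) ->
  measurable_fun setT g -> measurable_fun setT h ->
  measurable_fun setT (fun x => G (g x) (h x)).
Proof.
move=> lipG mg mh.
have K0 := lipschitz2_ge0 lipG.
apply: (measurability (@RGenInftyO.G R)) => [|_ [_ [c ->] <-]].
  exact: RGenInftyO.measurableE.
pose A (r s : rat) := [set x | G (ratr r) (ratr s) +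
  K * (`|g x - ratr r| + `|h x - ratr s|) < c].
rewrite (_ : setT `&` _ = \bigcup_r \bigcup_s A r s); last first.
  apply/seteqP; split => [x [_]|x [r _ [s _]]]; rewrite /= in_itv/=.
    (* with r and s within e of g x and h x, the bound loses at most 4 K e *)
    move=> Gc; pose e := (c - G (g x) (h x)) / (4 * K + 4).
    have e0 : 0 < e by rewrite divr_gt0 ?subr_gt0 ?ltr_wpDl ?mulr_ge0.
    have eE : e * (4 * K + 4) = c - G (g x) (h x).
      by rewrite divfK// gt_eqF// ltr_wpDl ?mulr_ge0.
    have [r] := rat_in_itvoo (ltr_pwDr e0 (lexx (g x))).
    have [s] := rat_in_itvoo (ltr_pwDr e0 (lexx (h x))).
    rewrite !in_itv/= => /andP[s1 s2] /andP[r1 r2].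
    exists r => //; exists s => //; rewrite /A/=.
    have := lipG (ratr r) (ratr s) (g x) (h x).
    rewrite (distrC (g x)) (distrC (h x)).
    rewrite [`|ratr r - _|]gtr0_norm ?subr_gt0//.
    rewrite [`|ratr s - _|]gtr0_norm ?subr_gt0//.
    rewrite ler_norml => /andP[_ ub].
    have : K * (ratr r - g x + (ratr s - h x)) <= K * (2 * e).
      by rewrite ler_wpM2l//; lra.
    nra.
  rewrite /A/= => lt_c; split => //; apply: le_lt_trans lt_c.
  have := lipG (g x) (h x) (ratr r) (ratr s).
  by rewrite ler_norml => /andP[_]; lra.
apply: bigcupT_measurable_rat => r; apply: bigcupT_measurable_rat => s.
pose phi x := G (ratr r) (ratr s) +
  K * (`|g x - ratr r| + `|h x - ratr s|).
have mphi : measurable_fun setT phi.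
  apply: measurable_funD => //; apply: measurable_funM => //.
  by apply: measurable_funD; apply: measurableT_comp => //;
    exact: measurable_funB.
rewrite (_ : A r s = setT `&` phi @^-1` `]-oo, c[); last first.
  by rewrite setTI; apply/seteqP; split => x; rewrite /= in_itv.
exact: mphi.
Qed.

Section kernel_field.
Context d (T : measurableType d) (R : realType) (mu : probability T R).
Context (q : R) (q1 : (1 <= q%:E)%E).

Local Notation E := (LfunType mu q1).
Local Notation N := (@Lq_seminorm _ _ _ mu _ q1).

Let muT : (mu : {measure set T -> \bar R}) setT = 1%E.
Proof. exact: probability_setT. Qed.

Let q_gt0 : 0 < q.
Proof. by rewrite -lte_fin (lt_le_trans _ q1). Qed.

Lemma Lfun_integrable1 (u : E) : mu.-integrable setT (EFin \o u).
Proof.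
apply/integrableP; split; first exact/measurable_EFinP/Lfun_measurable.
apply: le_lt_trans (L1norm_le_Lnorm q1 muT (Lfun_measurable u)) _.
exact: Lfunction_finite.
Qed.

Lemma L1norm_le_Lq_seminorm (u : E) : \int[mu]_x `|u x| <= N u.
Proof.
rewrite -lee_fin Lq_seminormE /Rintegral fineK.
  exact: (L1norm_le_Lnorm q1 muT (Lfun_measurable u)).
by have /integrable_abse/(integrable_fin_num measurableT) := Lfun_integrable1 u.
Qed.

Lemma Lnorm_affine_le (g : T -> R) (u : E) (A B : R) : 0 <= A -> 0 <= B ->
  measurable_fun setT g -> (forall x, `|g x| <= A * `|u x| + B) ->
  ('N[mu]_q%:E[EFin \o g] <= (A * N u + B)%:E)%E.
Proof.
move=> A0 B0 mg gAB; have mu_ := Lfun_measurable u.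
have mA : measurable_fun setT (fun x => A * `|u x|).
  by apply: measurable_funM => //; exact: measurableT_comp.
have mB : measurable_fun setT (cst B : T -> R) by exact: measurable_cst.
have gle := le_Lnorm mu q1 mg (measurable_funD mA mB).
apply: (le_trans (gle _)).
  by move=> x; apply: (le_trans (gAB x)); exact: ler_norm.
apply: (le_trans (minkowski_EFin mu mA mB q1)).
rewrite EFinD leeD//.
  have -> : (A * N u)%:E = (`|A|%:E * 'N[mu]_q%:E[EFin \o u])%E.
    by rewrite EFinM Lq_seminormE ger0_norm.
  rewrite -LnormZ; apply: (le_Lnorm mu q1 mA) => [|x /=].
    by apply: measurable_funM.
  by rewrite !normrM normr_id.
apply: (le_Lnorm_powR q1) => //.
by rewrite /= integral_cst// muT mule1 ger0_norm.
Qed.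

Context (f : R -> R) (G : R -> R -> R) (W : T * T -> R) (K1 K2 : R).
Hypothesis K1_ge0 : 0 <= K1.
Hypothesis f_lip : forall u v, `|f u - f v| <= K1 * `|u - v|.
Hypothesis G_lip : forall u v u' v',
  `|G u v - G u' v'| <= K2 * (`|u - u'| + `|v - v'|).
Hypothesis mW : measurable_fun setT W.
Hypothesis W01 : forall z, 0 <= W z <= 1.

Let K2_ge0 : 0 <= K2. Proof. exact: lipschitz2_ge0 G_lip. Qed.

Definition kernel_field (u : T -> R) (y : T) : R :=
  f (u y) + \int[mu]_y' (W (y, y') * G (u y) (u y')).

(** Tonelli's theorem, applied to the positive and negative parts of the
    integrand. *)
Lemma measurable_kernel_field (u : T -> R) : measurable_fun setT u ->
  measurable_fun setT (kernel_field u).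
Proof.
move=> mu_; apply: measurable_funD.
  apply: (measurable_lipschitz2_comp (G := fun x _ => f x) (K := K1)
    (h := cst 0)) => // a b a' b'.
  by rewrite (le_trans (f_lip _ _))// ler_wpM2l// lerDl.
pose h (z : T * T) : \bar R := (W z * G (u z.1) (u z.2))%:E.
have mh : measurable_fun setT h.
  apply/measurable_EFinP; apply: measurable_funM => //.
  by apply: measurable_lipschitz2_comp G_lip _ _; exact: measurableT_comp.
apply: (measurableT_comp (fine_measurable measurableT)).
rewrite (_ : (fun y => _) =
    (fubini_F mu h^\+ \- fubini_F mu h^\-)%E); last first.
  apply/funext => y /=; rewrite integralE; congr (_ - _)%E;
    apply: eq_integral => x _;
    by rewrite (funeposE, funenegE) (funeposE, funenegE).
apply: emeasurable_funB.
- apply: measurable_fun_fubini_tonelli_F; first exact: measurable_funepos.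
  by move=> z; exact: funepos_ge0.
- apply: measurable_fun_fubini_tonelli_F; first exact: measurable_funeneg.
  by move=> z; exact: funeneg_ge0.
Qed.

Lemma kernel_integrable (u : E) (y : T) (c : R) :
  mu.-integrable setT (EFin \o (fun y' => W (y, y') * G c (u y'))).
Proof.
have mWy : measurable_fun setT (fun y' => W (y, y')).
  by apply: (measurableT_comp mW); exact: pair1_measurable.
have mG : measurable_fun setT (fun y' => G c (u y')).
  exact: (measurable_lipschitz2_comp G_lip (measurable_cst c)
    (Lfun_measurable u)).
apply: (@le_integrable _ _ _ mu setT _ _
    (EFin \o (fun y' => `|G c 0| + K2 * `|u y'|))) => //.
- by apply/measurable_EFinP; apply: measurable_funM.
- move=> y' _ /=; rewrite lee_fin (le_trans _ (ler_norm _))// normrM.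
  have /andP[W0 W1] := W01 (y, y').
  apply: (@le_trans _ _ (1 * `|G c (u y')|)).
    by rewrite ler_wpM2r// ger0_norm.
  have := G_lip c (u y') c 0; rewrite subrr normr0 add0r subr0.
  have := ler_normD (G c (u y') - G c 0) (G c 0); rewrite subrK; lra.
rewrite (_ : _ \o _ = (fun x => (`|G c 0|)%:E + K2%:E * `|u x|%:E)%E)//.
apply: integrableD => //.
  exact: finite_measure_integrable_cst.
apply: integrableZl => //.
by have := integrable_abse (Lfun_integrable1 u).
Qed.

(** The kernel being at most 1, the integral term changes by at most
    K2 |u y - v y| from the first argument of G and by K2 ||u - v||_1 from the
    second. *)
Lemma kernel_field_dist (u v : E) (y : T) :
  `|kernel_field u y - kernel_field v y| <=
  (K1 + K2) * `|(u - v) y| + K2 * N (u - v).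
Proof.
have uvE x : (u - v) x = u x - v x by [].
rewrite /kernel_field opprD addrACA.
rewrite -RintegralB//; [|exact: kernel_integrable..].
have iI := integrableB measurableT (kernel_integrable u y (u y))
  (kernel_integrable v y (v y)).
have iuv := integrable_abse (Lfun_integrable1 (u - v)).
rewrite (le_trans (ler_normD _ _))// mulrDl -addrA lerD//.
rewrite (le_trans (le_normr_Rintegral _ _))//.
apply: (@le_trans _ _ (\int[mu]_y' (K2 * `|(u - v) y| + K2 * `|(u - v) y'|))).
  apply: le_Rintegral => //.
  - by have := integrable_abse iI.
  - rewrite (_ : _ \o _ =
      (fun x => (K2 * `|(u - v) y|)%:E + K2%:E * `|(u - v) x|%:E)%E)//.
    apply: integrableD => //; first exact: finite_measure_integrable_cst.
    exact: integrableZl.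
  move=> y' _; rewrite -mulrBr normrM.
  have /andP[W0 W1] := W01 (y, y'); rewrite (ger0_norm W0).
  apply: (@le_trans _ _ (1 * `|G (u y) (u y') - G (v y) (v y')|)).
    by rewrite ler_wpM2r.
  by rewrite mul1r -mulrDr !uvE G_lip.
rewrite RintegralD//.
- rewrite Rintegral_cst// muT mulr1 lerD2l RintegralZl//.
  by rewrite ler_wpM2l// L1norm_le_Lq_seminorm.
- exact: finite_measure_integrable_cst.
- rewrite (_ : _ \o _ = (fun x => K2%:E * `|(u - v) x|%:E)%E)//.
  exact: integrableZl.
Qed.

(** The field at 0 is bounded, and [kernel_field_dist] bounds the difference
    with it by an affine function of |u|. *)
Lemma kernel_field_Lfun (u : E) : kernel_field u \in Lfun mu q%:E.
Proof.
have mF v := measurable_kernel_field (Lfun_measurable (v : E)).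
rewrite inE; apply/andP; split; rewrite inE//= /finite_norm.
have F0 y : `|kernel_field (0 : E) y| <= `|f 0| + `|G 0 0|.
  rewrite (le_trans (ler_normD _ _))// lerD2l.
  rewrite (le_trans (le_normr_Rintegral _ (kernel_integrable 0 y 0)))//.
  have cstG : mu.-integrable setT (EFin \o (fun _ => `|G 0 0|)).
    exact: finite_measure_integrable_cst.
  apply: (@le_trans _ _ (\int[mu]_y' `|G 0 0|)).
    apply: le_Rintegral => //.
      by have := integrable_abse (kernel_integrable 0 y 0).
    move=> y' _ /=; have /andP[W0 W1] := W01 (y, y').
    by rewrite normrM (ger0_norm W0) ler_piMl.
  by rewrite Rintegral_cst// muT mulr1.
apply: le_lt_trans (Lnorm_affine_le (u := u) (A := K1 + K2)
  (B := K2 * N u + (`|f 0| + `|G 0 0|)) _ _ _ _) (ltry _) => //.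
- exact: addr_ge0.
- by rewrite !addr_ge0// mulr_ge0// Lq_seminorm_ge0.
move=> y; have := kernel_field_dist u 0 y; rewrite subr0.
have := ler_normD (kernel_field u y - kernel_field (0 : E) y)
  (kernel_field (0 : E) y).
by have := F0 y; rewrite subrK; lra.
Qed.

Definition kernel_fieldL (u : E) : E := Lfun_Sub q1 (kernel_field_Lfun u).

Lemma kernel_fieldL_lip (u v : E) :
  N (kernel_fieldL u - kernel_fieldL v) <= (K1 + K2 + K2) * N (u - v).
Proof.
rewrite -lee_fin Lq_seminormE mulrDl.
apply: Lnorm_affine_le.
- exact: addr_ge0.
- by rewrite mulr_ge0// Lq_seminorm_ge0.
- exact: Lfun_measurable.
- exact: kernel_field_dist.
Qed.

End kernel_field.

(** * Functions and classes in L^q(I) *)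

Lemma lebesgueI_setT (R : realType) : @lebesgueI R setT = 1%E.
Proof.
rewrite /lebesgueI /mrestr setTI lebesgue_measure_itv/= lte_fin ltr01.
by rewrite -EFinB subr0.
Qed.

HB.instance Definition _ (R : realType) :=
  Measure_isProbability.Build _ _ _ (@lebesgueI R) (lebesgueI_setT R).

Section lebesgueI_integral.
Context (R : realType).
Local Notation I := ([set` `[0%R, 1%R]] : set (measurableTypeR R)).

Lemma lebesgueI_setC : @lebesgueI R (~` I) = 0%E.
Proof. by rewrite /lebesgueI /mrestr setICl measure0. Qed.

Lemma lebesgueI_ae (P : R -> Prop) : (forall y, 0 <= y <= 1 -> P y) ->
  {ae @lebesgueI R, forall y, P y}.
Proof.
move=> HP; exists (~` I); split.
- by apply: measurableC; exact: measurable_itv.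
- exact: lebesgueI_setC.
- by move=> y /= nP; rewrite in_itv/= => yI; apply: nP; exact: HP.
Qed.

Lemma ge0_integral_lebesgueI (h : measurableTypeR R -> \bar R) :
  measurable_fun setT h -> (forall x, (0 <= h x)%E) ->
  (\int[@lebesgueI R]_x h x = \int[@lebesgue_measure R]_(x in I) h x)%E.
Proof.
move=> mh h0; have mI : measurable I by exact: measurable_itv.
rewrite (ge0_negligible_integral (measurableC mI) _ _ _ lebesgueI_setC)//.
rewrite setTD setCK; apply: eq_measure_integral => A mA AI.
by rewrite -[LHS]/(@lebesgue_measure R (A `&` I)) setIidl.
Qed.

Lemma Rintegral_lebesgueI (h : measurableTypeR R -> R) :
  measurable_fun setT h ->
  \int[@lebesgueI R]_x h x = \int[@lebesgue_measure R]_(x in I) h x.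
Proof.
move=> mh; have meh : measurable_fun setT (EFin \o h) by exact/measurable_EFinP.
rewrite /Rintegral; congr fine; rewrite integralE [RHS]integralE.
rewrite !ge0_integral_lebesgueI//.
- exact: measurable_funeneg.
- exact: measurable_funepos.
Qed.

End lebesgueI_integral.

Section quotient.
Context (R : realType) (q : R) (q1 : (1 <= q%:E)%E).
Local Notation E := (LfunType (@lebesgueI R) q1).
Local Notation N := (@Lq_seminorm _ _ _ (@lebesgueI R) _ q1).
Local Notation aeMfunI :=
  {mfun_ (@lebesgueI R), measurableTypeR R >-> measurableTypeR R}.
Local Open Scope quotient_scope.

Lemma LqI_Lfun (x : LqI q1) : (x : R -> R) \in Lfun (@lebesgueI R) q%:E.
Proof.
rewrite inE; apply/andP; split; rewrite inE/=.
  (* R and measurableTypeR R carry convertible sigma-algebras *)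
  move=> mD Y mY.
  have := @measurable_funP _ _ _ _ setT (repr (x : aeMfunI)).
  by move=> /(_ mD Y mY).

exact: Lebesgue_finite.
Qed.

Definition Lfun_of (x : LqI q1) : E := Lfun_Sub q1 (LqI_Lfun x).

Definition LqI_mfun (u : E) : {mfun measurableTypeR R >-> measurableTypeR R} :=
  HB.pack (u : measurableTypeR R -> measurableTypeR R)
    (isMeasurableFun.Build _ _ _ _ (u : measurableTypeR R -> measurableTypeR R)
      (Lfun_measurable u)).

Definition aeclass (u : E) : aeMfunI := \pi_(aeMfunI) (LqI_mfun u).

Lemma aeclassE (u : E) : {ae @lebesgueI R, forall y, aeclass u y = u y}.
Proof.
have : \pi_(aeMfunI) (repr (aeclass u)) = aeclass u by exact: reprK.
by move=> /eqquotP/asboolP; apply: filterS => y /(_ Logic.I).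
Qed.

Lemma aeclass_finite_norm (u : E) : finite_norm (@lebesgueI R) q%:E (aeclass u).
Proof.
rewrite /finite_norm (ae_eq_Lnorm q _ _ (aeclassE u)).
- exact: Lfunction_finite.
- exact: (measurable_funP (repr (aeclass u))).
- exact: Lfun_measurable.
Qed.

Definition LqI_of (u : E) : LqI q1 :=
  HB.pack (aeclass u)
    (isFinLebesgue.Build _ _ _ _ _ _ _ (aeclass_finite_norm u)).

Lemma LqI_ofE (u : E) : {ae @lebesgueI R, forall y, LqI_of u y = u y}.
Proof. exact: aeclassE. Qed.

(** An element wraps a class modulo almost everywhere equality together with a
    proof of finiteness, and such proofs are irrelevant. *)
Lemma LqI_eq (x z : LqI q1) : {ae @lebesgueI R, forall y, x y = z y} -> x = z.
Proof.
move=> xz.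
have : (x : aeMfunI) = z.
  rewrite -[LHS]reprK -[RHS]reprK; apply/eqquotP/asboolP.
  by apply: filterS xz => y /= + _.
case: x z {xz} => [x [[hx]]] [z [[hz]]] /= xz.
case: z / xz hz => hz.
by rewrite (Prop_irrelevance hx hz).
Qed.

Lemma Lfun_of_LqI_of (u : E) : N (Lfun_of (LqI_of u) - u) = 0.
Proof. by apply/Lq_seminorm_eq0; exact: LqI_ofE. Qed.

Lemma Lq_dist_Lfun_of (x z : LqI q1) :
  Lq_dist q x z = (N (Lfun_of x - Lfun_of z))%:E.
Proof. by rewrite Lq_seminormE. Qed.

End quotient.

(** * The flow of the graphon equation *)

Lemma cvge0P (R : realType) (T : Type) (A : set_system T) {FA : Filter A}
    (r : T -> R) : (forall x, 0 <= r x) ->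
  (r x)%:E @[x --> A] --> 0%E <->
  (forall e, 0 < e -> \forall x \near A, r x < e).
Proof.
move=> r0; split=> [/fine_cvgP[_ /cvgrPdist_lt rA] e e0|rA].
  apply: filterS (rA e e0) => x /=.
  by rewrite sub0r normrN ger0_norm.
apply: cvg_EFin; first exact: nearW.
apply/cvgrPdist_lt => e e0; apply: filterS (rA e e0) => x /=.
by rewrite sub0r normrN ger0_norm.
Qed.

Section graphon_flow.
Context (R : realType) (q : R) (q1 : (1 <= q%:E)%E).
Context (f : R -> R) (G : R -> R -> R) (W : R * R -> R) (K1 K2 : R).
Hypothesis K1_ge0 : 0 <= K1.
Hypothesis f_lip : forall u v, `|f u - f v| <= K1 * `|u - v|.
Hypothesis G_lip : forall u v u' v',
  `|G u v - G u' v'| <= K2 * (`|u - u'| + `|v - v'|).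
Hypothesis graphonW : graphon W.

Local Notation mu := (@lebesgueI R).
Local Notation E := (LfunType mu q1).
Local Notation N := (@Lq_seminorm _ _ _ mu _ q1).

(** W is constrained on the unit square only; cutting it off outside makes the
    field measurable and Lipschitz on the whole line, which carries the
    functions. *)
Definition graphon0 : measurableTypeR R * measurableTypeR R -> R :=
  W \_ unit_square.

Lemma measurable_graphon0 : measurable_fun setT graphon0.
Proof.
have [mW _ _] := graphonW.
have mQ : measurable (unit_square : set (R * R)).
  by apply: measurableX; exact: measurable_itv.
have /measurable_restrictT := mW.
by move=> /(_ mQ) mW0 mD Y mY; exact: mW0.
Qed.

Lemma graphon0_01 z : 0 <= graphon0 z <= 1.
Proof.
have [_ _ W01] := graphonW; rewrite /graphon0 patchE.
by case: ifPn => [/set_mem/W01//|_]; rewrite lexx ler01.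
Qed.

Definition graphon_fieldL : E -> E := kernel_fieldL K1_ge0 f_lip G_lip
  measurable_graphon0 graphon0_01.

Local Notation F := graphon_fieldL.
Local Notation L := (K1 + K2 + K2).

Lemma graphon_fieldL_lip u v : N (F u - F v) <= L * N (u - v).
Proof. exact: kernel_fieldL_lip. Qed.

Lemma graphon_fieldLE (x : LqI q1) :
  {ae mu, forall y, F (Lfun_of x) y = graphon_field f G W x y}.
Proof.
apply: lebesgueI_ae => y yI.
rewrite -[LHS]/(kernel_field mu f G graphon0 (Lfun_of x) y) /kernel_field.
congr (_ + _); rewrite Rintegral_lebesgueI.
  apply: eq_Rintegral => y' /set_mem y'I; congr (_ * _).
  have Qyy : unit_square (y, y') by split; rewrite /= in_itv.
  by rewrite /graphon0 patchE mem_set.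
apply: measurable_funM.
  by apply: (measurableT_comp measurable_graphon0); exact: pair1_measurable.
exact: (measurable_lipschitz2_comp G_lip (measurable_cst (Lfun_of x y))
  (Lfun_measurable (Lfun_of x))).
Qed.

Lemma is_solution_sub (J J' : set R) g (x : R -> LqI q1) : J' `<=` J ->
  is_solution f G W J g x -> is_solution f G W J' g x.
Proof.
move=> JJ' [x0 [x' [[dx cx] ex]]]; split => //; exists x'; split; last first.
  by move=> t /JJ'; exact: ex.
split=> t /JJ' Jt.
- move=> A /(dx t Jt).
  by apply: (@filterS _ (dnbhs t) _ _ _ _) => s /= H /JJ'; exact: H.
- move=> A /(cx t Jt).
  by apply: (@filterS _ (nbhs t) _ _ _ _) => s /= H /JJ'; exact: H.
Qed.

Lemma Lq_dist_quotient (x x' : R -> LqI q1) (s t : R) :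
  Lq_dist q (fun y => (x s y - x t y) / (s - t)) (x' t) =
  (N ((s - t)^-1 *: (Lfun_of (x s) - Lfun_of (x t)) - Lfun_of (x' t)))%:E.
Proof.
rewrite Lq_seminormE; apply: eq_Lnorm => y /=; congr EFin.
by rewrite mulrC.
Qed.

(** Multiplying the difference quotient by s - t; the prescribed derivative and
    the field agree almost everywhere, hence at distance 0. *)
Lemma is_solution_solves T g (x : R -> LqI q1) :
  is_solution f G W `[0, T] g x -> solves N F T (fun t => Lfun_of (x t)).
Proof.
move=> [_ [x' [[dx _] ex]]] t tT e e0.
have Jt : `[0, T]%classic t by rewrite /= in_itv.
have := dx t Jt; under eq_fun do rewrite Lq_dist_quotient.
move=> /cvge0P => /(_ (fun s => Lq_seminorm_ge0 _) e e0).
rewrite /prop_near1/= /within/= => /nbhs_ballP[d /= d0 dH].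
exists d => // s sT std /=.
have [->|st] := eqVneq s t.
  rewrite !subrr scale0r subr0 normr0 mulr0.
  by rewrite (seminorm0 (@Lq_seminormZ _ _ _ mu _ q1)).
have Js : `[0, T]%classic s by rewrite /= in_itv.
have := dH s; rewrite /ball/= distrC => /(_ std st Js) H.
have st0 : s - t != 0 by rewrite subr_eq0.
have F0 : N (Lfun_of (x' t) - F (Lfun_of (x t))) = 0.
  apply/Lq_seminorm_eq0; have := graphon_fieldLE (x t).
  apply: filterS2 (ex t Jt) => y xy Fy.
  by rewrite Fy -xy.
have -> : Lfun_of (x s) - Lfun_of (x t) - (s - t) *: F (Lfun_of (x t)) =
  (s - t) *:
   (((s - t)^-1 *: (Lfun_of (x s) - Lfun_of (x t)) - Lfun_of (x' t)) +
    (Lfun_of (x' t) - F (Lfun_of (x t)))).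
  by rewrite addrA subrK scalerBr scalerA mulfV// scale1r.
rewrite Lq_seminormZ mulrC ler_wpM2r//.
by rewrite (le_trans (Lq_seminormD _ _))// F0 addr0 ltW.
Qed.

(** Dividing the defect by |s - t| gives the derivative F (x t); its continuity
    comes from that of F and the resulting Lipschitz bound on x. *)
Lemma is_solution_of_estimate g (x : R -> LqI q1) : x 0 = g ->
  (forall T, 0 <= T -> exists C, forall s t, 0 <= s <= T -> 0 <= t <= T ->
    N (Lfun_of (x s) - Lfun_of (x t) - (s - t) *: F (Lfun_of (x t))) <=
    C * (s - t) ^+ 2) ->
  is_solution f G W `[0, +oo[ g x.
Proof.
move=> x0 est; split => //; pose x' t : LqI q1 := LqI_of (F (Lfun_of (x t))).
have x'E t : N (Lfun_of (x' t) - F (Lfun_of (x t))) = 0.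
  exact: Lfun_of_LqI_of.
have x'F t : {ae mu, forall y, x' t y = graphon_field f G W (x t) y}.
  have := graphon_fieldLE (x t).
  by apply: filterS2 (LqI_ofE (F (Lfun_of (x t)))) => y -> ->.
clearbody x'; exists x'; split=> //.
have NZ := @Lq_seminormZ _ _ _ mu _ q1.
have ND := @Lq_seminormD _ _ _ mu _ q1.
(* on [0, t + 1] the estimate holds with a nonnegative constant *)
have loc t : 0 <= t -> exists2 C, 0 <= C & forall s, 0 <= s -> `|s - t| < 1 ->
    N (Lfun_of (x s) - Lfun_of (x t) - (s - t) *: F (Lfun_of (x t))) <=
    C * `|s - t| ^+ 2.
  move=> t0; have t10 : 0 <= t + 1 by rewrite addr_ge0.
  have [C HC] := est _ t10; exists `|C| => // s s0.
  rewrite ltr_norml => /andP[_ st].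
  rewrite real_normK ?num_real//.
  apply: (@le_trans _ _ (C * (s - t) ^+ 2)).
    by apply: HC; rewrite ?s0 ?t0/=; lra.
  by rewrite ler_wpM2r ?sqr_ge0// ler_norm.
split => t; rewrite /= in_itv/= andbT => t0; have [C C0 HC] := loc t t0.
- under eq_fun do rewrite Lq_dist_quotient.
  apply/cvge0P => [s|e e0]; first exact: Lq_seminorm_ge0.
  rewrite /prop_near1/= /within/=; apply/nbhs_ballP.
  exists (Num.min 1 (e / (C + 1))).
    by rewrite /= lt_min ltr01 divr_gt0// ltr_wpDl.
  move=> s; rewrite /ball/= distrC lt_min => /andP[s1 se] st.
  rewrite in_itv/= andbT => s0.
  have st0 : s - t != 0 by rewrite subr_eq0.
  have -> : (s - t)^-1 *: (Lfun_of (x s) - Lfun_of (x t)) - Lfun_of (x' t) =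
      (s - t)^-1 *:
        (Lfun_of (x s) - Lfun_of (x t) - (s - t) *: F (Lfun_of (x t))) +
      (F (Lfun_of (x t)) - Lfun_of (x' t)).
    by rewrite [in RHS]scalerBr scalerA mulVf// scale1r subrKA.
  apply: le_lt_trans (ND _ _) _.
  rewrite (seminormB NZ (F _)) x'E addr0 NZ normfV.
  rewrite ltr_pdivrMl ?normr_gt0//; apply: le_lt_trans (HC s s0 s1) _.
  rewrite expr2 mulrCA ltr_pM2l ?normr_gt0//.
  move: se; rewrite ltr_pdivlMr ?ltr_wpDl// mulrC => /(le_lt_trans _); apply.
  by rewrite ler_wpM2r// lerDl.
- under eq_fun do rewrite Lq_dist_Lfun_of.
  apply/cvge0P => [s|e e0]; first exact: Lq_seminorm_ge0.
  rewrite /prop_near1/= /within/=; apply/nbhs_ballP.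
  have L0 : 0 <= L.
    have K20 := lipschitz2_ge0 G_lip; by rewrite !addr_ge0.
  pose D := C + N (F (Lfun_of (x t))).
  have D0 : 0 <= D by rewrite addr_ge0// Lq_seminorm_ge0.
  exists (Num.min 1 (e / (L * D + 1))).
    by rewrite /= lt_min ltr01 divr_gt0// ltr_wpDl// mulr_ge0.
  move=> s; rewrite /ball/= distrC lt_min => /andP[s1 se].
  rewrite in_itv/= andbT => s0.
  have Nxst : N (Lfun_of (x s) - Lfun_of (x t)) <= `|s - t| * D.
    rewrite (le_trans (seminorm_near ND _ ((s - t) *: F (Lfun_of (x t)))))//.
    rewrite NZ /D mulrDr addrC lerD2r (le_trans (HC s s0 s1))//.
    by rewrite expr2 mulrCA ler_wpM2l// ler_piMr// ltW.
  apply: (@le_lt_trans _ _ (`|s - t| * (L * D))); last first.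
    move: se; rewrite ltr_pdivlMr ?ltr_wpDl ?mulr_ge0// => /(le_lt_trans _).
    by apply; rewrite ler_wpM2l// lerDl.
  rewrite (le_trans (seminorm_triangle ND (F (Lfun_of (x s))) _ _))// x'E add0r.
  rewrite (le_trans (seminorm_triangle ND (F (Lfun_of (x t))) _ _))//.
  rewrite (seminormB NZ _ (Lfun_of (x' t))) x'E addr0.
  by rewrite (le_trans (graphon_fieldL_lip _ _))// mulrCA ler_wpM2l.
Qed.

(** [solution_exists] starts at a function, up to null distance; taking classes
    at every time restores the exact initial value. *)
Lemma flow_exists (g : LqI q1) :
  exists x : R -> LqI q1, is_solution f G W `[0, +oo[ g x.
Proof.
have L0 : 0 <= L by have K20 := lipschitz2_ge0 G_lip; rewrite !addr_ge0.
have ND := @Lq_seminormD _ _ _ mu _ q1; have NZ := @Lq_seminormZ _ _ _ mu _ q1.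
have [y [y0 est]] := solution_exists ND NZ L0 graphon_fieldL_lip
  (fun u C => Lq_complete (lebesgueI_setT R)) (Lfun_of g).
exists (fun t => LqI_of (y t)); apply: is_solution_of_estimate => [|T T0].
  apply: LqI_eq; have /Lq_seminorm_eq0 := y0.
  by apply: filterS2 (LqI_ofE (y 0)) => z -> ->.
have [C HC] := est T T0; exists C => s t sT tT.
apply: le_trans (HC s t sT tT).
apply: (null_perturbation ND NZ graphon_fieldL_lip (y := y)
  (z := fun r => Lfun_of (LqI_of (y r)))) => r.
exact: Lfun_of_LqI_of.
Qed.

Lemma flow_stable T g h (x z : R -> LqI q1) :
  is_solution f G W `[0, T] g x -> is_solution f G W `[0, T] h z ->
  forall t, 0 <= t <= T ->
  N (Lfun_of (x t) - Lfun_of (z t)) <= N (Lfun_of g - Lfun_of h) * expR (L * t).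
Proof.
move=> sx sz t tT.
have L0 : 0 <= L by have K20 := lipschitz2_ge0 G_lip; rewrite !addr_ge0.
have ND := @Lq_seminormD _ _ _ mu _ q1; have NZ := @Lq_seminormZ _ _ _ mu _ q1.
have := solves_stable ND NZ L0 graphon_fieldL_lip (is_solution_solves sx)
  (is_solution_solves sz) tT.
by case: sx sz => -> _ [-> _].
Qed.

End graphon_flow.

Lemma lipschitz2_sum (R : realType) (G : R -> R -> R) (K : R) :
  lipschitz2_on setT K G -> forall u v u' v',
  `|G u v - G u' v'| <= `|K| * (`|u - u'| + `|v - v'|).
Proof.
move=> GK u v u' v'; apply: (le_trans (GK u v u' v' Logic.I Logic.I)).
apply: (@le_trans _ _ (`|K| * Num.sqrt ((u - u') ^+ 2 + (v - v') ^+ 2))).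
  by rewrite ler_wpM2r ?sqrtr_ge0// ler_norm.
rewrite ler_wpM2l// -[leRHS]ger0_norm ?addr_ge0//.
rewrite -(sqrtr_sqr (`|u - u'| + `|v - v'|)) ler_wsqrtr//.
rewrite [leRHS]sqrrD !real_normK ?num_real// lerD2r lerDl.
by rewrite mulrn_wge0// mulr_ge0.
Qed.

Theorem theorem4 (R : realType) (a b : R) (f : R -> R) (G : R -> R -> R)
    (L_f L_G : R) (W : R * R -> R) (p : R) (hp : 2 <= p)
    (hab : a <= b)
    (hf : L_f.-lipschitz_(`[a, b]) f)
    (hG : lipschitz2_on (`[a, b] `*` `[a, b]) L_G G)
    (hf_ext : exists K : R, K.-lipschitz f)
    (hG_ext : exists K : R, lipschitz2_on setT K G)
    (hW : graphon W)
    (hWcont : ae_continuous W)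
    (hWp : Lp_unit_square p W)
    (hS : positively_invariant f G W (state_space (conjugate_ge1 hp) a b)) :
  exists Phi : LqI (conjugate_ge1 hp) -> R -> LqI (conjugate_ge1 hp),
    [/\ forall g, state_space _ a b g -> forall T : R, 0 < T ->
          is_solution f G W `[0, T] g (Phi g) /\
          (forall x, is_solution f G W `[0, T] g x ->
             forall t, t \in `[0, T] -> x t = Phi g t),
        forall g, state_space _ a b g ->
          is_solution f G W `[0, +oo[ g (Phi g) /\
          (forall t, 0 <= t -> state_space _ a b (Phi g t)) &
        forall T : R, 0 < T -> forall g, state_space _ a b g ->
          forall eps : R, 0 < eps ->
          exists2 delta : R, 0 < delta &
            forall h, state_space _ a b h ->
              (Lq_dist (p / (p - 1)) h g < delta%:E)%E ->
              (sup_dist T (Phi h) (Phi g) < eps%:E)%E].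

Proof.
have [Kf hKf] := hf_ext; have [KG /lipschitz2_sum G_lip] := hG_ext.
have f_lip u v : `|f u - f v| <= `|Kf| * `|u - v|.
  have := hKf (u, v) (conj Logic.I Logic.I); rewrite /= => /le_trans; apply.
  by rewrite ler_wpM2r// ler_norm.
set q1 := conjugate_ge1 hp in hS *.
have Kf0 : 0 <= `|Kf| by exact: normr_ge0.
have [Phi HPhi] := choice (flow_exists (q1 := q1) Kf0 f_lip G_lip hW).
have PhiT g T : is_solution f G W `[0, T] g (Phi g).
  apply: is_solution_sub (HPhi g) => t.
  by rewrite /= !in_itv/= andbT => /andP[].
have stable := flow_stable (q1 := q1) Kf0 f_lip G_lip hW.
exists Phi; split.
- move=> g Sg T T0; split=> // x sx t; rewrite in_itv/= => tT.
  apply: LqI_eq.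
  apply/(@Lq_seminorm_eq0 _ _ _ (@lebesgueI R) _ q1
    (Lfun_of (x t)) (Lfun_of (Phi g t))).
  apply/eqP; rewrite eq_le Lq_seminorm_ge0 andbT.
  rewrite (le_trans (stable T g g x _ sx (PhiT g T) t tT))//.
  by rewrite subrr (seminorm0 (@Lq_seminormZ _ _ _ (@lebesgueI R) _ q1)) mul0r.
- move=> g Sg; split=> // t t0.
  (* t + 1 keeps the time horizon positive when t = 0 *)
  apply: (hS (t + 1) g (Phi g)) => //; first by rewrite ltr_wpDl.
  by rewrite in_itv/= t0 lerDl ler01.
move=> T T0 g Sg eps eps0.
set L := `|Kf| + `|KG| + `|KG|.
have L0 : 0 <= L by rewrite !addr_ge0.
(* half of eps makes the bound on the supremum strict *)
exists (eps / 2 / expR (L * T)) => [|h Sh].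
  by rewrite !divr_gt0// expR_gt0.
rewrite Lq_dist_Lfun_of lte_fin ltr_pdivlMr ?expR_gt0// => hg.
apply: (@le_lt_trans _ _ (eps / 2)%:E); last first.
  by rewrite lte_fin ltr_pdivrMr// ltr_pMr// ltr1n.
apply: ub_ereal_sup => _ [t tT <-].
rewrite Lq_dist_Lfun_of lee_fin (le_trans _ (ltW hg))//.
move: tT; rewrite /= in_itv/= => tT.
rewrite (le_trans (stable T h g _ _ (PhiT h T) (PhiT g T) t tT))//.
rewrite ler_wpM2l ?Lq_seminorm_ge0// ler_expR ler_wpM2l//.
by case/andP: tT.
Qed.
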